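(* For any $0<\hat{\lambda}<\lambda_U$ and every integer $n\ge 0$ we have $$|u_d(t_n;x)|\leq \max_{|z|=\hat{\lambda}}|U_d(z;x)|\,\hat{\lambda}^{-n}.$$ It therefore follows that, for any $\epsilon>0$ arbitrarily small (with $\epsilon<\lambda_U$), $$|u_d(t_n;x)|=\mathcal{O}\left((\lambda_U-\epsilon)^{-n}\right)\quad\text{as } n\to\infty.$$ Here $u_d(t_n;x)=\frac{1}{2\pi i}\int_{|z|=\lambda}\frac{U_d(z;x)}{z^{n+1}}\,dz$ for any $0<\lambda<\lambda_U$.
   Context: Let $\Omega\subset\mathbb{R}^3$ be a bounded domain with (sufficiently regular) boundary $\Gamma$ and exterior $\Omega^{+}=\mathbb{R}^3\setminus\overline{\Omega}$; $x$ denotes a fixed point of $\Omega^+$. Helmholtz solution operator and scattering poles: for $k\in\mathbb{C}$ consider the exterior Helmholtz problem $\Delta v+k^2v=0$ in $\Omega^+$, $v=g$ on $\Gamma$, with $v$ outgoing, meaning that for $r=|x|>r_0$ (where the sphere of radius $r_0$ surrounds $\Omega$) $v$ can be expanded as $v(x)=\sum_{n=0}^\infty\sum_{m=-n}^n a_{n,m}h_n^{(1)}(kr)Y_n^m(x/|x|)$, with $h_n^{(1)}$ the spherical Hankel functions of the first kind and $Y_n^m$ the spherical harmonics. $\mathcal{B}(k)$ denotes the solution operator mapping the Dirichlet data $g$ to the solution $v$. It is a known fact that $\mathcal{B}$ is a meromorphic operator-valued function of $k$, whose poles $p_j$, $j=1,2,\dots$, satisfy $\mathrm{Im}\{p_j\}<0$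 (scattering poles). Time-stepping rule: $c>0$ is the wave speed, $\Delta t>0$ is the time step, $t_n=n\Delta t$, and $\gamma(z)=\sum_{n\ge 0}\gamma_n z^n$, where $(\gamma_n)$ are the coefficients of a multistep rule $\frac{1}{c\Delta t}\sum_{j=0}^n\gamma_{n-j}Y_d(t_j)=\mathcal{L}Y_d(t_n)$, all but finitely many $\gamma_n$ being zero; thus $\gamma$ is a (nonconstant) polynomial. Put $k_z=i\gamma(z)/(c\Delta t)$ and $\mathcal{B}_U(z):=\mathcal{B}(k_z)$. Boundary data: $g(t;x)$, $t\ge0$, $x\in\Gamma$, is the given Dirichlet data of the wave equation, and $G(z;x)=\sum_{n=0}^\infty g(t_n;x)z^n$. $\lambda_G$ is the radius of analyticity of $G$, i.e. $z\mapsto G(z;\cdot)$ is analytic in $|z|<\lambda_G$ ($\lambda_G=\infty$ is allowed). $\lambda_{\mathcal{B}}:=\min_j|z_j|$, where the $z_j$ are the complex numbers for which $i\gamma(z_j)/(c\Delta t)$ is one of the scattering poles, and $\lambda_U:=\min\{\lambda_{\mathcal{B}},\lambda_G\}$, a finite number. $U_d(z;x):=[\mathcal{B}_U(z)G(z;\cdot)](x)$, i.e. $U_d(z;\cdot)$ is the outgoing (with wavenumber $k_z$) solution of $\left(\frac{\gamma(z)}{c\Delta t}\right)^2U_d-\Delta U_d=0$ in $\Omega^+$ with $U_d=G(z;\cdot)$ on $\Gamma$. The function $z\mapsto U_d(z;x)$ is analytic for $|z|<\lambda_U$. Contours are positively oriented; by Cauchy's theorem $u_d(t_n;x)$ does not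 depend on the choice of $\lambda\in(0,\lambda_U)$. The implied constant in $\mathcal{O}$ may depend on $x$ and $\epsilon$, but not on $n$. *)

(* Defs.v *)
From Stdlib Require Import Reals ZArith.
From Coquelicot Require Import Coquelicot.
Set Implicit Arguments.
Unset Strict Implicit.
Open Scope R_scope.

(* Coquelicot's product structures provide the usual topology and the vector
   space operations [plus], [scal] of R^3. *)
Definition R3 : Type := (R * R * R)%type.

Definition enorm (x : R3) : R :=
  let '(x1, x2, x3) := x in sqrt (x1 ^ 2 + x2 ^ 2 + x3 ^ 2).

Definition closure (A : R3 -> Prop) : R3 -> Prop :=
  fun x => ~ locally x (fun y => ~ A y).

Definition boundary (A : R3 -> Prop) : R3 -> Prop :=
  fun x => closure A x /\ ~ locally x A.

Definition exterior (A : R3 -> Prop) : R3 -> Prop := fun x => ~ closure A x.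

Definition bounded_set (A : R3 -> Prop) : Prop :=
  exists M : R, forall x, A x -> enorm x <= M.

Definition compact_subset (K A : R3 -> Prop) : Prop :=
  closed K /\ bounded_set K /\ (forall x, K x -> A x).

Definition connected_set (A : R3 -> Prop) : Prop :=
  forall U V : R3 -> Prop, open U -> open V ->
    (forall x, A x -> U x \/ V x) ->
    (exists x, A x /\ U x) -> (exists x, A x /\ V x) ->
    exists x, A x /\ U x /\ V x.

Definition bounded_domain (Om : R3 -> Prop) : Prop :=
  (exists x, Om x) /\ open Om /\ connected_set Om /\ bounded_set Om.

Definition Cexp (z : C) : C :=
  (exp (Re z) * cos (Im z), exp (Re z) * sin (Im z)).

(* Coquelicot's [Series] is real-valued. *)
Definition CSeries (a : nat -> C) : C :=
  (Series (fun n => Re (a n)), Series (fun n => Im (a n))).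

Definition is_Cseries (a : nat -> C) (s : C) : Prop :=
  @is_series R_AbsRing C_R_NormedModule a s.

Definition ex_Cseries (a : nat -> C) : Prop := exists s, is_Cseries a s.

Definition Csum (a : nat -> C) (n : nat) : C := @sum_n C_AbelianMonoid a n.

Definition continuous_within (A : R3 -> Prop) (f : R3 -> C) : Prop :=
  forall x, A x -> filterlim f (within A (locally x)) (locally (f x)).

Definition along (f : R3 -> C) (x e : R3) : R -> C :=
  fun t => f (plus x (scal t e)).

Definition ex_ddir (e : R3) (f : R3 -> C) (x : R3) : Prop :=
  ex_derive (fun t => Re (along f x e t)) 0 /\
  ex_derive (fun t => Im (along f x e t)) 0.

Definition ddir (e : R3) (f : R3 -> C) (x : R3) : C :=
  (Derive (fun t => Re (along f x e t)) 0,
   Derive (fun t => Im (along f x e t)) 0).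

Definition C1_on (A : R3 -> Prop) (f : R3 -> C) : Prop :=
  forall e, (forall x, A x -> ex_ddir e f x) /\ continuous_within A (ddir e f).

Definition C2_on (A : R3 -> Prop) (f : R3 -> C) : Prop :=
  C1_on A f /\ forall e, C1_on A (ddir e f).

Definition laplacian (f : R3 -> C) (x : R3) : C :=
  let D2 e := ddir e (ddir e f) x in
  (D2 (1, 0, 0) + D2 (0, 1, 0) + D2 (0, 0, 1))%C.

(* Spherical Hankel functions of the first kind (DLMF 10.49.6):
     h_n(z) = e^{iz} sum_{j=0}^n i^{j-n-1} (n+j)! / (2^j j! (n-j)!) z^{-j-1}. *)
Definition sph_hankel1 (n : nat) (z : C) : C :=
  (Cexp (Ci * z) *
   Csum (fun j =>
     Ci ^ j / Ci ^ S n
     * RtoC (INR (fact (n + j)) / (2 ^ j * INR (fact j) * INR (fact (n - j))))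
     / z ^ S j) n)%C.

(* m-th derivative of the Legendre polynomial P_n, by Rodrigues' formula. *)
Definition legendre_deriv (n m : nat) (t : R) : R :=
  Derive_n (fun s => (s ^ 2 - 1) ^ n / (2 ^ n * INR (fact n))) (n + m) t.

(* In Cartesian coordinates of the unit sphere,
     sin(theta)^|m| e^{i m phi} = (w1 + i w2)^m if 0 <= m,
                                  (w1 - i w2)^|m| if m < 0,
   and P_n^{|m|}(cos theta) = sin(theta)^|m| (d/dt)^|m| P_n(w3); the
   Condon-Shortley sign is omitted. *)
Definition sph_harmonic (n : nat) (m : Z) (w : R3) : C :=
  let '(w1, w2, w3) := w in
  let a := Z.abs_nat m in
  (RtoC (sqrt ((2 * INR n + 1) / (4 * PI)
               * (INR (fact (n - a)) / INR (fact (n + a))))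
         * legendre_deriv n a w3)
   * ((w1, if (m <? 0)%Z then (- w2)%R else w2) : C) ^ a)%C.

(* h_n(k r) is undefined at k = 0.  There the outgoing radial function is the
   limit as k -> 0 of a suitable multiple of h_n(k r), namely r^{-(n+1)}; the
   multiple is absorbed in the coefficient of the expansion. *)
Definition outgoing_radial (k : C) (n : nat) (r : R) : C :=
  if Ceq_dec k 0 then RtoC (/ r ^ S n) else sph_hankel1 n (k * RtoC r)%C.

Definition outgoing (Om : R3 -> Prop) (k : C) (v : R3 -> C) : Prop :=
  exists r0 : R, 0 < r0 /\ (forall y, Om y -> enorm y < r0) /\
  exists a : nat -> Z -> C, forall x : R3, r0 < enorm x ->
    is_Cseries
      (fun n => Csum (fun j =>
         let m := (Z.of_nat j - Z.of_nat n)%Z in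
         (a n m * outgoing_radial k n (enorm x)
          * sph_harmonic n m (scal (/ enorm x)%R x))%C) (2 * n))
      (v x).

(* Classical solutions: v is twice continuously differentiable in the exterior
   and continuous up to the boundary. *)
Definition outgoing_solution (Om : R3 -> Prop) (k : C) (g v : R3 -> C) : Prop :=
  let Gam := boundary Om in
  let Ext := exterior Om in
  C2_on Ext v /\
  continuous_within (fun x => Ext x \/ Gam x) v /\
  (forall x, Ext x -> (laplacian v x + k ^ 2 * v x)%C = 0) /\
  (forall y, Gam y -> v y = g y) /\
  outgoing Om k v.

(* Elements of C(Gamma) are represented by functions on R3, of which only the
   restriction to Gamma matters.  C(exterior) carries the topology of uniform
   convergence on compact sets. *)
Definition data (Om : R3 -> Prop) (g : R3 -> C) : Prop :=
  continuous_within (boundary Om) g.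

Definition data_unit_ball (Om : R3 -> Prop) (g : R3 -> C) : Prop :=
  data Om g /\ forall y, boundary Om y -> Cmod (g y) <= 1.

Definition operator : Type := (R3 -> C) -> (R3 -> C).

Definition solution_operator (Om : R3 -> Prop) (k : C) (T : operator) : Prop :=
  forall g, data Om g ->
    outgoing_solution Om k g (T g) /\
    forall v, outgoing_solution Om k g v ->
      forall x, exterior Om x -> v x = T g x.

Definition bounded_operator (Om : R3 -> Prop) (T : operator) : Prop :=
  (forall g, data Om g -> continuous_within (exterior Om) (T g)) /\
  (forall (a : C) g h x, data Om g -> data Om h -> exterior Om x ->
     T (fun y => a * g y + h y)%C x = (a * T g x + T h x)%C) /\
  (forall K, compact_subset K (exterior Om) ->
     exists M, forall g x, data_unit_ball Om g -> K x -> Cmod (T g x) <= M).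

(* Convergence in operator norm, for every compact subset of the exterior. *)
Definition operator_lim (Om : R3 -> Prop) (S : nat -> operator) (T : operator)
  : Prop :=
  forall K, compact_subset K (exterior Om) ->
  forall eps : R, 0 < eps ->
  exists N : nat, forall n, (N <= n)%nat ->
  forall g x, data_unit_ball Om g -> K x -> Cmod (S n g x - T g x)%C < eps.

Definition op_psum (A : nat -> operator) (w : C) (n : nat) : operator :=
  fun g x => Csum (fun j => (w ^ j * A j g x)%C) n.

Definition op_analytic_at (Om : R3 -> Prop) (B : C -> operator) (k0 : C)
  : Prop :=
  exists (rho : R) (A : nat -> operator),
    0 < rho /\ (forall j, bounded_operator Om (A j)) /\
    forall k, Cmod (k - k0)%C < rho ->
      operator_lim Om (op_psum A (k - k0)%C) (B k).

(* Pole of order N >= 1: in a punctured disc around k0,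
     B(k) = sum_{j >= 0} (k - k0)^{j-N} A_j   with A_0 <> 0. *)
Definition op_pole (Om : R3 -> Prop) (B : C -> operator) (k0 : C) : Prop :=
  exists (N : nat) (rho : R) (A : nat -> operator),
    (1 <= N)%nat /\ 0 < rho /\ (forall j, bounded_operator Om (A j)) /\
    (exists g x, data Om g /\ exterior Om x /\ A 0%nat g x <> 0) /\
    forall k, 0 < Cmod (k - k0)%C < rho ->
      operator_lim Om (op_psum A (k - k0)%C)
        (fun g x => (k - k0) ^ N * B k g x)%C.

Definition op_meromorphic (Om : R3 -> Prop) (B : C -> operator) : Prop :=
  forall k0, op_analytic_at Om B k0 \/ op_pole Om B k0.

Definition genG (g : R -> R3 -> C) (dt : R) (z : C) (y : R3) : C :=
  CSeries (fun n => g (INR n * dt)%R y * z ^ n)%C.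

(* Analyticity at z0 of a function of z with values in C(Gamma). *)
Definition data_analytic_at (Om : R3 -> Prop) (F : C -> R3 -> C) (z0 : C)
  : Prop :=
  exists (rho : R) (c : nat -> R3 -> C),
    0 < rho /\ (forall m, data Om (c m)) /\
    forall z, Cmod (z - z0)%C < rho ->
    forall eps : R, 0 < eps ->
    exists N : nat, forall n, (N <= n)%nat ->
    forall y, boundary Om y ->
      Cmod (Csum (fun m => (z - z0) ^ m * c m y)%C n - F z y)%C < eps.

(* The convergence clause ensures that the value of [genG] is the sum of the
   series and not a default value of [CSeries]. *)
Definition genG_analytic_in_disc
  (Om : R3 -> Prop) (g : R -> R3 -> C) (dt r : R) : Prop :=
  forall z, Cmod z < r ->
    (forall y, boundary Om y -> ex_Cseries (fun n => g (INR n * dt)%R y * z ^ n)%C)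
    /\ data_analytic_at Om (genG g dt) z.

Definition lambda_G (Om : R3 -> Prop) (g : R -> R3 -> C) (dt : R) : Rbar :=
  Lub_Rbar (genG_analytic_in_disc Om g dt).

(* N bounds the degree of the polynomial gamma. *)
Definition gamma_poly (gam : nat -> R) (N : nat) (z : C) : C :=
  Csum (fun n => RtoC (gam n) * z ^ n)%C N.

Definition k_of (gam : nat -> R) (N : nat) (c dt : R) (z : C) : C :=
  (Ci * gamma_poly gam N z / RtoC (c * dt))%C.

(* Smallest modulus of the z with k_z a pole.  The infimum is p_infty if there
   is no such z, and is attained otherwise as the poles are isolated. *)
Definition lambda_B (Om : R3 -> Prop) (B : C -> operator)
  (gam : nat -> R) (N : nat) (c dt : R) : Rbar :=
  Glb_Rbar (fun r => exists z, op_pole Om B (k_of gam N c dt z) /\ r = Cmod z).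

Definition U_d (B : C -> operator) (gam : nat -> R) (N : nat) (c dt : R)
  (g : R -> R3 -> C) (z : C) (x : R3) : C :=
  B (k_of gam N c dt z) (genG g dt z) x.

(* Parametrised by z = r e^{it}, so that dz = i z dt. *)
Definition circle_integral (f : C -> C) (r : R) : C :=
  @RInt C_R_CompleteNormedModule
    (fun t => let z := (RtoC r * Cexp (Ci * RtoC t))%C in
              (f z * (Ci * z))%C)
    0 (2 * PI).

Definition u_d (B : C -> operator) (gam : nat -> R) (N : nat) (c dt : R)
  (g : R -> R3 -> C) (lam : R) (n : nat) (x : R3) : C :=
  (/ (2 * RtoC PI * Ci)
   * circle_integral (fun z => U_d B gam N c dt g z x / z ^ S n) lam)%C.

Definition max_on_circle (h : C -> R) (r M : R) : Prop :=
  (exists z, Cmod z = r /\ h z = M) /\ (forall z, Cmod z = r -> h z <= M).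

(* Main.v *)
(** Below [lamU] the wavenumber [k_z] avoids the poles of [B], so near each point
    [U_d] is a double power series: the operators [B(k)] expand in powers of
    [k - k_{z0}] and the data [G(z)] in powers of [z - z0].  Bounded coefficients
    give a first-order Taylor formula for [U_d] with a uniform quadratic
    remainder, hence a holomorphic function with Lipschitz derivative.  For such
    an [F], the Cauchy-Riemann equations in polar coordinates show that the mean
    of [F] over a circle does not depend on the radius, so the contour defining
    [u_d] may be moved to [|z| = lamh], where the integrand is bounded
    trivially. *)

Require Import Defs.
From Stdlib Require Import Reals Lra Lia List Classical ClassicalEpsilon
  FunctionalExtensionality.
From Coquelicot Require Import Coquelicot.
Open Scope R_scope.

(** The delicate point is that the operator and its argument vary together with [z]. [B] is known
    only through limits in operator norm, tested on data of size at most one, and as a solution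
    operator, whose definition does not mention linearity. Linearity of [B k] at [x] is recovered
    from that of the expansion coefficients, but leaving the unit ball needs homogeneity of [B k]
    beforehand. Uniqueness for the exterior problem supplies it; real factors suffice for rescaling.
    The quadratic remainder, with one constant for all pairs of points near [z0], is built into the
    notion of holomorphy: exchanging the two points makes the derivative Lipschitz. Differentiation
    under the integral sign is then legitimate at once, without an argument of Goursat type. *)

(** * Complex partial sums and limits of sequences *)

Lemma Csum_O (a : nat -> C) : Csum a 0 = a 0%nat.
Proof. unfold Csum; now rewrite sum_O. Qed.

Lemma Csum_S (a : nat -> C) n : Csum a (S n) = (Csum a n + a (S n))%C.
Proof. unfold Csum; now rewrite sum_Sn. Qed.

Lemma Csum_ext (a b : nat -> C) n :
  (forall j, a j = b j) -> Csum a n = Csum b n.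
Proof.
  intros H; induction n as [|n IH]; rewrite ?Csum_O, ?Csum_S, ?IH, ?H; auto.
Qed.

Lemma Csum_plus (a b : nat -> C) n :
  Csum (fun j => a j + b j)%C n = (Csum a n + Csum b n)%C.
Proof.
  induction n as [|n IH]; rewrite ?Csum_O, ?Csum_S, ?IH; [easy | ring].
Qed.

Lemma Csum_scal (c : C) (a : nat -> C) n :
  Csum (fun j => c * a j)%C n = (c * Csum a n)%C.
Proof.
  induction n as [|n IH]; rewrite ?Csum_O, ?Csum_S, ?IH; [easy | ring].
Qed.

Lemma Re_Csum (a : nat -> C) n : Re (Csum a n) = sum_n (fun j => Re (a j)) n.
Proof.
  induction n as [|n IH]; [now rewrite Csum_O, sum_O |].
  rewrite Csum_S, sum_Sn, <- IH; reflexivity.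
Qed.

Lemma Im_Csum (a : nat -> C) n : Im (Csum a n) = sum_n (fun j => Im (a j)) n.
Proof.
  induction n as [|n IH]; [now rewrite Csum_O, sum_O |].
  rewrite Csum_S, sum_Sn, <- IH; reflexivity.
Qed.

Lemma Cmod_triangle_minus (a b : C) : Cmod (a - b) <= Cmod a + Cmod b.
Proof.
  unfold Cminus; rewrite <- (Cmod_opp b); apply Cmod_triangle.
Qed.

Lemma Cmod_minus_sym (a b : C) : Cmod (a - b) = Cmod (b - a).
Proof. rewrite <- Cmod_opp; f_equal; ring. Qed.

Lemma im_le_Cmod (c : C) : Rabs (Im c) <= Cmod c.
Proof.
  eapply Rle_trans; [apply Rmax_r | apply Rmax_Cmod].
Qed.

Lemma Cmod_le_abs (c : C) : Cmod c <= Rabs (Re c) + Rabs (Im c).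
Proof.
  replace c with (RtoC (Re c) + Ci * RtoC (Im c))%C at 1
    by (destruct c; apply injective_projections; simpl; ring).
  eapply Rle_trans; [apply Cmod_triangle |].
  rewrite Cmod_mult, Cmod_Ci, !Cmod_R; lra.
Qed.

Lemma Cmod_le_eps_0 (a : C) : (forall eps, 0 < eps -> Cmod a < eps) -> a = 0.
Proof.
  intros H; apply Cmod_eq_0; apply Rle_antisym; [| apply Cmod_ge_0].
  apply Rnot_lt_le; intros Ha; specialize (H _ Ha); lra.
Qed.

Definition Cconv (u : nat -> C) (l : C) : Prop :=
  forall eps, 0 < eps -> exists n0, forall n, (n0 <= n)%nat -> Cmod (u n - l) < eps.

Lemma Cconv_ext (u v : nat -> C) l :
  (forall n, u n = v n) -> Cconv u l -> Cconv v l.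
Proof.
  intros E H eps He; destruct (H eps He) as [n0 H0]; exists n0.
  intros n Hn; rewrite <- E; auto.
Qed.

Lemma Cconv_plus (u v : nat -> C) l m :
  Cconv u l -> Cconv v m -> Cconv (fun n => u n + v n)%C (l + m)%C.
Proof.
  intros Hu Hv eps He.
  destruct (Hu (eps / 2)) as [p Hp]; [lra |].
  destruct (Hv (eps / 2)) as [q Hq]; [lra |].
  exists (p + q)%nat; intros n Hn.
  specialize (Hp n ltac:(lia)); specialize (Hq n ltac:(lia)).
  replace (u n + v n - (l + m))%C with ((u n - l) + (v n - m))%C by ring.
  eapply Rle_lt_trans; [apply Cmod_triangle | lra].
Qed.

Lemma Cconv_scal (c : C) (u : nat -> C) l :
  Cconv u l -> Cconv (fun n => c * u n)%C (c * l)%C.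
Proof.
  intros Hu eps He.
  pose proof (Cmod_ge_0 c) as Hc.
  destruct (Hu (eps / (Cmod c + 1))) as [p Hp]; [apply Rdiv_lt_0_compat; lra |].
  exists p; intros n Hn; specialize (Hp n Hn).
  replace (c * u n - c * l)%C with (c * (u n - l))%C by ring.
  rewrite Cmod_mult.
  apply (Rmult_lt_compat_l (Cmod c + 1)) in Hp; [| lra].
  replace ((Cmod c + 1) * (eps / (Cmod c + 1))) with eps in Hp by (field; lra).
  pose proof (Cmod_ge_0 (u n - l)); nra.
Qed.

Lemma Cconv_minus (u v : nat -> C) l m :
  Cconv u l -> Cconv v m -> Cconv (fun n => u n - v n)%C (l - m)%C.
Proof.
  intros Hu Hv.
  replace (l - m)%C with (l + (-(1)) * m)%C by ring.
  apply Cconv_ext with (fun n => u n + (-(1)) * v n)%C; [intros; ring |].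
  apply Cconv_plus, Cconv_scal; auto.
Qed.

Lemma Cconv_le (u : nat -> C) l M :
  Cconv u l -> (forall n, Cmod (u n) <= M) -> Cmod l <= M.
Proof.
  intros Hu HM; apply Rnot_lt_le; intros Hl.
  destruct (Hu (Cmod l - M)) as [p Hp]; [lra |].
  specialize (Hp p (le_n p)); specialize (HM p).
  pose proof (Cmod_triangle_minus (u p) (u p - l)) as H.
  replace (u p - (u p - l))%C with l in H by ring; lra.
Qed.

Lemma Cconv_unique (u : nat -> C) l m : Cconv u l -> Cconv u m -> l = m.
Proof.
  intros Hl Hm.
  assert (H : Cmod (l - m) <= 0).
  { apply Cconv_le with (fun n => u n - u n)%C; [now apply Cconv_minus |].
    intros n; replace (u n - u n)%C with (RtoC 0) by ring; rewrite Cmod_0; lra. }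
  assert (E : (l - m)%C = 0).
  { apply Cmod_eq_0, Rle_antisym; [exact H | apply Cmod_ge_0]. }
  replace l with ((l - m) + m)%C by ring; rewrite E; ring.
Qed.

Lemma Csum_geom_le (b : nat -> C) M :
  (forall j, Cmod (b j) <= M * (/ 2) ^ j) -> forall n, Cmod (Csum b n) <= 2 * M.
Proof.
  intros H n.
  assert (HM : 0 <= M).
  { pose proof (H 0%nat) as H0; pose proof (Cmod_ge_0 (b 0%nat)); simpl in H0; lra. }
  (* Subtracting the tail of the geometric series that is still to come lets the induction close. *)
  cut (Cmod (Csum b n) <= 2 * M - M * (/ 2) ^ n).
  { pose proof (pow_le (/ 2) n ltac:(lra)); nra. }
  induction n as [|n IH].
  - rewrite Csum_O; specialize (H 0%nat); simpl in *; lra.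
  - rewrite Csum_S; eapply Rle_trans; [apply Cmod_triangle |].
    specialize (H (S n)); simpl in *; lra.
Qed.

Lemma real_geom_ex_series (b : nat -> R) M :
  (forall j, Rabs (b j) <= M * (/ 2) ^ j) -> ex_series b.
Proof.
  intros H; apply (@ex_series_le R_AbsRing R_CompleteNormedModule)
    with (fun j => M * (/ 2) ^ j); [exact H |].
  apply (@ex_series_scal R_AbsRing R_NormedModule M (fun j => (/ 2) ^ j)).
  apply ex_series_geom; rewrite Rabs_pos_eq; lra.
Qed.

(** [CSeries] is a pair of total real [Series]; geometric domination of both components makes it the
    genuine limit. *)
Lemma Cconv_geom (b : nat -> C) M :
  (forall j, Cmod (b j) <= M * (/ 2) ^ j) -> Cconv (Csum b) (CSeries b).
Proof.
  intros H.
  assert (H1 : ex_series (fun j => Re (b j))).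
  { apply real_geom_ex_series with M; intros j.
    eapply Rle_trans; [apply re_le_Cmod | apply H]. }
  assert (H2 : ex_series (fun j => Im (b j))).
  { apply real_geom_ex_series with M; intros j.
    eapply Rle_trans; [apply im_le_Cmod | apply H]. }
  apply Series_correct in H1; apply Series_correct in H2.
  intros eps He.
  pose proof (proj1 (filterlim_locally _ _) H1 (mkposreal (eps / 2) ltac:(lra))) as [p Hp].
  pose proof (proj1 (filterlim_locally _ _) H2 (mkposreal (eps / 2) ltac:(lra))) as [q Hq].
  exists (p + q)%nat; intros n Hn.
  specialize (Hp n ltac:(lia)); specialize (Hq n ltac:(lia)).
  change (Rabs (sum_n (fun j => Re (b j)) n - Series (fun j => Re (b j))) < eps / 2) in Hp.
  change (Rabs (sum_n (fun j => Im (b j)) n - Series (fun j => Im (b j))) < eps / 2) in Hq.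
  rewrite <- Re_Csum in Hp; rewrite <- Im_Csum in Hq.
  eapply Rle_lt_trans; [apply Cmod_le_abs |].
  change (Re (Csum b n - CSeries b)) with (Re (Csum b n) - Series (fun j => Re (b j))).
  change (Im (Csum b n - CSeries b)) with (Im (Csum b n) - Series (fun j => Im (b j))).
  lra.
Qed.

(** * Second-order Taylor estimates for power series *)

(* The derivative [j * w ^ (j - 1)], computed by the Leibniz rule. *)
Fixpoint dpow (j : nat) (w : C) : C :=
  match j with
  | O => 0
  | S j => w * dpow j w + w ^ j
  end%C.

(** The sharp factors [j] and [j * (j - 1) / 2] are coarsened to [2 ^ j] and [4 ^ j]: the induction
    closes with these, and the resulting series stay geometric. *)
Lemma pow_taylor (rho : R) (z w : C) (j : nat) :
  0 < rho -> Cmod z <= rho -> Cmod w <= rho ->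
  Cmod (z ^ j - w ^ j) <= (2 * rho) ^ j / rho * Cmod (z - w) /\
  Cmod (dpow j w) <= (2 * rho) ^ j / rho /\
  Cmod (z ^ j - w ^ j - dpow j w * (z - w))
    <= (4 * rho) ^ j / rho ^ 2 * Cmod (z - w) ^ 2.
Proof.
  intros Hr Hz Hw.
  pose proof (Cmod_ge_0 z); pose proof (Cmod_ge_0 w).
  set (d := Cmod (z - w)); assert (Hd : 0 <= d) by apply Cmod_ge_0.
  induction j as [|j (IH1 & IH2 & IH3)].
  - simpl dpow; simpl Cpow.
    replace (1 - 1)%C with (RtoC 0) by ring.
    replace (0 - 0 * (z - w))%C with (RtoC 0) by ring.
    rewrite Cmod_0; simpl pow.
    assert (0 < / rho) by now apply Rinv_0_lt_compat.
    assert (0 < / (rho * (rho * 1))) by (apply Rinv_0_lt_compat; nra).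
    repeat split; unfold Rdiv; try nra.
  - assert (P : Cmod (w ^ j) <= rho ^ j)
      by (rewrite Cmod_pow; apply pow_incr; lra).
    assert (P1 : rho ^ j <= (2 * rho) ^ j) by (apply pow_incr; lra).
    assert (P2 : (2 * rho) ^ j <= (4 * rho) ^ j) by (apply pow_incr; lra).
    assert (Q : 0 <= rho ^ j) by (apply pow_le; lra).
    pose proof (Cmod_ge_0 (w ^ j)).
    set (X := (2 * rho) ^ j) in *; set (Y := (4 * rho) ^ j) in *.
    assert (E1 : (2 * rho) ^ S j / rho = 2 * X) by (simpl; fold X; field; lra).
    assert (E2 : (4 * rho) ^ S j / rho ^ 2 = 4 * Y / rho) by (simpl; fold Y; field; lra).
    rewrite E1, E2.
    assert (F1 : rho * (X / rho) = X) by (field; lra).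
    assert (F2 : rho * (Y / rho ^ 2) = Y / rho) by (field; lra).
    assert (F3 : X / rho <= Y / rho)
      by (apply Rmult_le_compat_r; [left; now apply Rinv_0_lt_compat | auto]).
    assert (F4 : 0 <= X / rho)
      by (apply Rmult_le_pos; [lra | left; now apply Rinv_0_lt_compat]).
    repeat split.
    + replace (z ^ S j - w ^ S j)%C with (z * (z ^ j - w ^ j) + w ^ j * (z - w))%C
        by (simpl; ring).
      eapply Rle_trans; [apply Cmod_triangle |]; rewrite !Cmod_mult; fold d.
      assert (Cmod z * Cmod (z ^ j - w ^ j) <= rho * (X / rho * d))
        by (apply Rmult_le_compat; auto; apply Cmod_ge_0).
      assert (Cmod (w ^ j) * d <= X * d) by (apply Rmult_le_compat_r; lra).
      replace (rho * (X / rho * d)) with (X * d) in * by (field; lra).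
      lra.
    + simpl dpow; eapply Rle_trans; [apply Cmod_triangle |]; rewrite Cmod_mult.
      assert (Cmod w * Cmod (dpow j w) <= rho * (X / rho))
        by (apply Rmult_le_compat; auto; apply Cmod_ge_0).
      lra.
    + replace (z ^ S j - w ^ S j - dpow (S j) w * (z - w))%C
        with (w * (z ^ j - w ^ j - dpow j w * (z - w)) + (z - w) * (z ^ j - w ^ j))%C
        by (simpl; ring).
      eapply Rle_trans; [apply Cmod_triangle |]; rewrite !Cmod_mult; fold d.
      assert (Cmod w * Cmod (z ^ j - w ^ j - dpow j w * (z - w))
              <= rho * (Y / rho ^ 2 * d ^ 2))
        by (apply Rmult_le_compat; auto; apply Cmod_ge_0).
      assert (d * Cmod (z ^ j - w ^ j) <= d * (X / rho * d))
        by (apply Rmult_le_compat_l; auto).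
      replace (rho * (Y / rho ^ 2 * d ^ 2)) with (Y / rho * d ^ 2) in * by (field; lra).
      replace (d * (X / rho * d)) with (X / rho * d ^ 2) in * by ring.
      assert (X / rho * d ^ 2 <= Y / rho * d ^ 2)
        by (apply Rmult_le_compat_r; [apply pow2_ge_0 | auto]).
      assert (0 <= Y / rho * d ^ 2)
        by (apply Rmult_le_pos; [lra | apply pow2_ge_0]).
      replace (4 * Y / rho * d ^ 2) with (4 * (Y / rho * d ^ 2)) by (field; lra).
      lra.
Qed.

Definition power_sum (a : nat -> C) (z f : C) : Prop :=
  Cconv (Csum (fun j => z ^ j * a j)%C) f.

Definition dpower_sum (a : nat -> C) (w : C) : C :=
  CSeries (fun j => dpow j w * a j)%C.

(* The bounds depend on the coefficients only through [S], hence are uniform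
   over families of power series. *)
Lemma power_sum_taylor (r : R) :
  0 < r ->
  exists K, 0 < K /\ forall (a : nat -> C) (S : R) (z w fz fw : C),
    (forall j, Cmod (a j) * r ^ j <= S) ->
    Cmod z <= r / 8 -> Cmod w <= r / 8 ->
    power_sum a z fz -> power_sum a w fw ->
    Cmod fz <= K * S /\
    Cmod (fz - fw) <= K * S * Cmod (z - w) /\
    Cmod (dpower_sum a w) <= K * S /\
    Cmod (fz - fw - dpower_sum a w * (z - w)) <= K * S * Cmod (z - w) ^ 2.
Proof.
  (* Now [4 * rho = r / 2], so the coarsest bound [(4 * rho) ^ j] of [pow_taylor] against [a j] of
     size [S / r ^ j] gives the ratio one half. *)
  intros Hr; set (rho := r / 8).
  assert (Hrho : 0 < rho) by (unfold rho; lra).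
  assert (I1 : 0 < / rho) by now apply Rinv_0_lt_compat.
  assert (I2 : 0 < / rho ^ 2) by (apply Rinv_0_lt_compat, pow_lt; auto).
  (* The 2 is the sum of the geometric series; the three summands serve the estimates of the values,
     of the first-order quantities and of the remainder. *)
  exists (2 * (1 + / rho + / rho ^ 2)); split; [lra |].
  intros a S z w fz fw Ha Hz Hw Hfz Hfw.
  set (d := Cmod (z - w)); assert (Hd : 0 <= d) by apply Cmod_ge_0.
  assert (Hd2 : 0 <= d ^ 2) by apply pow2_ge_0.
  assert (HS : 0 <= S).
  { eapply Rle_trans; [| apply (Ha 0%nat)].
    apply Rmult_le_pos; [apply Cmod_ge_0 | apply pow_le; lra]. }
  assert (T : forall u M t j, Cmod u <= t ^ j * M -> 0 <= M -> 0 <= t <= 4 * rho ->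
                Cmod (u * a j) <= (S * M) * (/ 2) ^ j).
  { intros u M t j Hu HM Ht; rewrite Cmod_mult.
    assert (t ^ j <= (/ 2) ^ j * r ^ j).
    { rewrite <- Rpow_mult_distr; apply pow_incr; unfold rho in Ht; lra. }
    pose proof (pow_le (/ 2) j ltac:(lra)).
    pose proof (Cmod_ge_0 (a j)); specialize (Ha j).
    apply Rle_trans with ((/ 2) ^ j * r ^ j * M * Cmod (a j)).
    - apply Rmult_le_compat_r; auto.
      eapply Rle_trans; [apply Hu | apply Rmult_le_compat_r; auto].
    - replace ((/ 2) ^ j * r ^ j * M * Cmod (a j))
        with ((/ 2) ^ j * M * (Cmod (a j) * r ^ j)) by ring.
      replace (S * M * (/ 2) ^ j) with ((/ 2) ^ j * M * S) by ring.
      apply Rmult_le_compat_l; [apply Rmult_le_pos |]; auto. }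
  pose proof (fun j => pow_taylor rho z w j Hrho Hz Hw) as P.
  assert (HD : Cconv (Csum (fun j => dpow j w * a j)%C) (dpower_sum a w)).
  { apply Cconv_geom with (S * / rho); intros j.
    apply T with (2 * rho); [apply P | lra | lra]. }
  assert (HE : Cconv (Csum (fun j => (z ^ j - w ^ j) * a j)%C) (fz - fw)%C).
  { eapply Cconv_ext; [| apply Cconv_minus; [apply Hfz | apply Hfw]].
    intros n; simpl; induction n as [|n IH];
      rewrite ?Csum_O, ?Csum_S, <- ?IH; ring. }
  assert (B : forall (b : nat -> C) l M X, Cconv (Csum b) l ->
     (forall j, Cmod (b j) <= S * (M * X) * (/ 2) ^ j) -> 0 <= X ->
     0 <= M <= 1 + / rho + / rho ^ 2 ->
     Cmod l <= 2 * (1 + / rho + / rho ^ 2) * S * X).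
  { intros b l M X Hl Hb HX HM.
    eapply Rle_trans.
    - eapply Cconv_le; [apply Hl | apply Csum_geom_le, Hb].
    - replace (2 * (S * (M * X))) with (M * (2 * S * X)) by ring.
      replace (2 * (1 + / rho + / rho ^ 2) * S * X)
        with ((1 + / rho + / rho ^ 2) * (2 * S * X)) by ring.
      apply Rmult_le_compat_r; [| lra].
      apply Rmult_le_pos; lra. }
  repeat split.
  - rewrite <- Rmult_1_r; eapply (B _ _ 1 1); [apply Hfz | | lra | lra].
    intros j; apply T with rho; [| lra | lra].
    rewrite Cmod_pow, !Rmult_1_r; apply pow_incr; split; [apply Cmod_ge_0 | auto].
  - eapply (B _ _ (/ rho)); [apply HE | | auto | lra].
    intros j; apply T with (2 * rho); [| apply Rmult_le_pos; lra | lra].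
    rewrite <- Rmult_assoc; apply P.
  - rewrite <- Rmult_1_r; eapply (B _ _ (/ rho)); [apply HD | | lra | lra].
    intros j; apply T with (2 * rho); [| lra | lra].
    rewrite Rmult_1_r; apply P.
  - eapply (B _ _ (/ rho ^ 2)).
    + eapply (Cconv_ext _ (Csum (fun j => (z ^ j - w ^ j - dpow j w * (z - w)) * a j)%C));
        [| apply Cconv_minus; [apply HE | rewrite Cmult_comm; apply Cconv_scal, HD]].
      intros n; simpl; induction n as [|n IH];
        rewrite ?Csum_O, ?Csum_S, <- ?IH; ring.
    + intros j; apply T with (4 * rho); [| apply Rmult_le_pos; lra | lra].
      rewrite <- Rmult_assoc; apply P.
    + auto.
    + lra.
Qed.

(** * Holomorphic functions with a uniform quadratic remainder *)

(* A quantitative form of "[F] is holomorphic near [z0]": the uniform quadratic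
   remainder makes the derivative Lipschitz, and is stable under products. *)
Definition taylor2_on (F D : C -> C) (z0 : C) (rho K : R) : Prop :=
  forall z w, Cmod (z - z0) < rho -> Cmod (w - z0) < rho ->
    Cmod (F z - F w - D w * (z - w)) <= K * Cmod (z - w) ^ 2.

Definition holo_at (F : C -> C) (z0 : C) : Prop :=
  exists rho K D, 0 < rho /\ taylor2_on F D z0 rho K.

Definition lipschitz_chart (F D : C -> C) (z0 : C) (rho K : R) : Prop :=
  0 < rho /\ 0 <= K /\ taylor2_on F D z0 rho K /\
  (forall z w, Cmod (z - z0) < rho -> Cmod (w - z0) < rho ->
     Cmod (F z) <= K /\ Cmod (D z) <= K /\
     Cmod (F z - F w) <= K * Cmod (z - w) /\
     Cmod (D z - D w) <= K * Cmod (z - w)).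

(** Adding the remainders at [(z, w)] and [(w, z)] cancels the values of [F] and leaves
    [(D z - D w) * (z - w)]. As this is quadratic in the distance, [D] is Lipschitz, and the other
    bounds follow on a small disc. *)
Lemma holo_at_chart (F : C -> C) (z0 : C) :
  holo_at F z0 -> exists rho K D, lipschitz_chart F D z0 rho K.
Proof.
  intros (rho & K & D & Hrho & H).
  (* [holo_at] fixes no sign for its constant. Below, a radius of at most 1 turns Lipschitz bounds
     around [z0] into plain bounds. *)
  set (k := Rabs K); assert (Hk : 0 <= k) by apply Rabs_pos.
  set (r := Rmin rho 1).
  assert (Hr : 0 < r) by (apply Rmin_pos; lra).
  assert (Hr1 : r <= 1) by apply Rmin_r.
  assert (Hr2 : r <= rho) by apply Rmin_l.
  assert (H' : forall z w, Cmod (z - z0) < r -> Cmod (w - z0) < r ->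
     Cmod (F z - F w - D w * (z - w)) <= k * Cmod (z - w) ^ 2).
  { intros z w Hz Hw; eapply Rle_trans; [apply H; lra |].
    apply Rmult_le_compat_r; [apply pow2_ge_0 | apply Rle_abs]. }
  assert (L : forall z w, Cmod (z - z0) < r -> Cmod (w - z0) < r ->
     Cmod (D z - D w) <= 2 * k * Cmod (z - w)).
  { intros z w Hz Hw.
    destruct (Ceq_dec z w) as [<- | Hn].
    { replace (D z - D z)%C with (RtoC 0) by ring.
      rewrite Cmod_0; apply Rmult_le_pos; [lra | apply Cmod_ge_0]. }
    assert (0 < Cmod (z - w)).
    { apply Cmod_gt_0; intros E; apply Hn.
      replace z with ((z - w) + w)%C by ring; rewrite E; ring. }
    apply Rmult_le_reg_r with (Cmod (z - w)); auto.
    rewrite <- Cmod_mult.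
    replace ((D z - D w) * (z - w))%C with
      ((F z - F w - D w * (z - w)) + (F w - F z - D z * (w - z)))%C by ring.
    eapply Rle_trans; [apply Cmod_triangle |].
    pose proof (H' z w Hz Hw); pose proof (H' w z Hw Hz) as H2.
    rewrite (Cmod_minus_sym w z) in H2; lra. }
  assert (Hc : Cmod (z0 - z0) < r)
    by (replace (z0 - z0)%C with (RtoC 0) by ring; rewrite Cmod_0; lra).
  assert (T : forall a b : C, Cmod a <= Cmod b + Cmod (a - b)).
  { intros a b; replace a with (b + (a - b))%C at 1 by ring; apply Cmod_triangle. }
  assert (DB : forall w, Cmod (w - z0) < r -> Cmod (D w) <= Cmod (D z0) + 2 * k).
  { intros w Hw; specialize (T (D w) (D z0)); specialize (L w z0 Hw Hc).
    assert (2 * k * Cmod (w - z0) <= 2 * k * 1) by (apply Rmult_le_compat_l; lra).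
    lra. }
  assert (diam : forall z w, Cmod (z - z0) < r -> Cmod (w - z0) < r ->
             Cmod (z - w) <= 2).
  { intros z w Hz Hw; replace (z - w)%C with ((z - z0) - (w - z0))%C by ring.
    eapply Rle_trans; [apply Cmod_triangle_minus | lra]. }
  pose proof (Cmod_ge_0 (D z0)); pose proof (Cmod_ge_0 (F z0)).
  set (M := Cmod (D z0) + 4 * k).
  assert (FL : forall z w, Cmod (z - z0) < r -> Cmod (w - z0) < r ->
     Cmod (F z - F w) <= M * Cmod (z - w)).
  { intros z w Hz Hw.
    specialize (H' z w Hz Hw); specialize (DB w Hw); specialize (diam z w Hz Hw).
    specialize (T (F z - F w)%C (D w * (z - w))%C); rewrite Cmod_mult in T.
    set (d := Cmod (z - w)) in *; assert (Hd : 0 <= d) by apply Cmod_ge_0.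
    assert (Cmod (D w) * d <= (Cmod (D z0) + 2 * k) * d)
      by (apply Rmult_le_compat_r; auto).
    assert (k * d ^ 2 <= k * (2 * d)) by (apply Rmult_le_compat_l; nra).
    unfold M; lra. }
  exists r, (M + Cmod (F z0) + M), D; unfold M in *.
  split; [auto |]; split; [lra |]; split.
  - intros z w Hz Hw; eapply Rle_trans; [apply H'; auto |].
    apply Rmult_le_compat_r; [apply pow2_ge_0 | lra].
  - intros z w Hz Hw; repeat split.
    + specialize (T (F z) (F z0)); specialize (FL z z0 Hz Hc).
      assert ((Cmod (D z0) + 4 * k) * Cmod (z - z0) <= (Cmod (D z0) + 4 * k) * 1)
        by (apply Rmult_le_compat_l; lra).
      lra.
    + specialize (DB z Hz); lra.
    + eapply Rle_trans; [apply FL; auto |].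
      apply Rmult_le_compat_r; [apply Cmod_ge_0 | lra].
    + eapply Rle_trans; [apply L; auto |].
      apply Rmult_le_compat_r; [apply Cmod_ge_0 | lra].
Qed.

Lemma holo_at_const (c z0 : C) : holo_at (fun _ => c) z0.
Proof.
  exists 1, 0, (fun _ => 0%C); split; [lra |]; intros z w _ _.
  replace (c - c - 0 * (z - w))%C with (RtoC 0) by ring; rewrite Cmod_0; lra.
Qed.

Lemma holo_at_id (z0 : C) : holo_at (fun z => z) z0.
Proof.
  exists 1, 0, (fun _ => 1%C); split; [lra |]; intros z w _ _.
  replace (z - w - 1 * (z - w))%C with (RtoC 0) by ring; rewrite Cmod_0; lra.
Qed.

Lemma holo_at_plus (F G : C -> C) (z0 : C) :
  holo_at F z0 -> holo_at G z0 -> holo_at (fun z => F z + G z)%C z0.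
Proof.
  intros (r & K & D & Hr & HF) (s & L & E & Hs & HG).
  exists (Rmin r s), (K + L), (fun w => D w + E w)%C; split; [now apply Rmin_pos |].
  pose proof (Rmin_l r s); pose proof (Rmin_r r s).
  intros z w Hz Hw.
  specialize (HF z w ltac:(lra) ltac:(lra)); specialize (HG z w ltac:(lra) ltac:(lra)).
  replace (F z + G z - (F w + G w) - (D w + E w) * (z - w))%C with
    ((F z - F w - D w * (z - w)) + (G z - G w - E w * (z - w)))%C by ring.
  eapply Rle_trans; [apply Cmod_triangle | lra].
Qed.

Lemma holo_at_mult (F G : C -> C) (z0 : C) :
  holo_at F z0 -> holo_at G z0 -> holo_at (fun z => F z * G z)%C z0.
Proof.
  intros HF HG.
  apply holo_at_chart in HF; apply holo_at_chart in HG.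
  destruct HF as (r & K & D & Hr & HK & HF & BF).
  destruct HG as (s & L & E & Hs & HL & HG & BG).
  exists (Rmin r s), (3 * (K * L)), (fun w => D w * G w + F w * E w)%C.
  split; [now apply Rmin_pos |].
  pose proof (Rmin_l r s); pose proof (Rmin_r r s).
  intros z w Hz Hw.
  specialize (HF z w ltac:(lra) ltac:(lra)); specialize (HG z w ltac:(lra) ltac:(lra)).
  destruct (BF z w ltac:(lra) ltac:(lra)) as (B1 & _ & B2 & _).
  destruct (BG w z ltac:(lra) ltac:(lra)) as (B3 & B4 & _).
  (* Weighting the remainder of [G] by [F z] and that of [F] by [G w] leaves one cross term,
     quadratic because [F] is Lipschitz. The three terms account for the factor 3. *)
  replace (F z * G z - F w * G w - (D w * G w + F w * E w) * (z - w))%C with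
    (F z * (G z - G w - E w * (z - w)) + (G w * (F z - F w - D w * (z - w))
      + (F z - F w) * (E w * (z - w))))%C by ring.
  eapply Rle_trans; [apply Cmod_triangle |].
  eapply Rle_trans; [apply Rplus_le_compat_l, Cmod_triangle |].
  rewrite !Cmod_mult.
  set (d := Cmod (z - w)) in *; assert (Hd : 0 <= d) by apply Cmod_ge_0.
  assert (Cmod (F z) * Cmod (G z - G w - E w * (z - w)) <= K * (L * d ^ 2))
    by (apply Rmult_le_compat; auto; apply Cmod_ge_0).
  assert (Cmod (G w) * Cmod (F z - F w - D w * (z - w)) <= L * (K * d ^ 2))
    by (apply Rmult_le_compat; auto; apply Cmod_ge_0).
  assert (Cmod (F z - F w) * (Cmod (E w) * d) <= (K * d) * (L * d)).
  { apply Rmult_le_compat; auto; try apply Cmod_ge_0.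
    - apply Rmult_le_pos; auto; apply Cmod_ge_0.
    - apply Rmult_le_compat_r; auto. }
  lra.
Qed.

Lemma holo_at_pow (F : C -> C) (n : nat) (z0 : C) :
  holo_at F z0 -> holo_at (fun z => F z ^ n)%C z0.
Proof.
  intros H; induction n as [|n IH]; [apply (holo_at_const 1) |].
  now apply (holo_at_mult F (fun z => F z ^ n)%C).
Qed.

Lemma holo_at_Csum (F : nat -> C -> C) (n : nat) (z0 : C) :
  (forall j, holo_at (F j) z0) -> holo_at (fun z => Csum (fun j => F j z) n) z0.
Proof.
  intros H; induction n as [|n IH].
  - replace (fun z => Csum (fun j => F j z) 0) with (F 0%nat); [easy |].
    apply functional_extensionality; intros z; now rewrite Csum_O.
  - replace (fun z => Csum (fun j => F j z) (S n))
      with (fun z => Csum (fun j => F j z) n + F (S n) z)%C.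
    + now apply holo_at_plus.
    + apply functional_extensionality; intros z; now rewrite Csum_S.
Qed.

(** The remainder is exactly [(z - w) ^ 2 / (z * w ^ 2)], and on the disc of radius
    [m = Cmod z0 / 2] both moduli stay above [m]. *)
Lemma holo_at_inv (z0 : C) : z0 <> 0 -> holo_at Cinv z0.
Proof.
  intros Hz0; apply Cmod_gt_0 in Hz0.
  set (m := Cmod z0 / 2); assert (Hm : 0 < m) by (unfold m; lra).
  exists m, (/ m ^ 3), (fun w => - (/ w * / w))%C; split; [auto |].
  assert (Q : forall z, Cmod (z - z0) < m -> z <> 0 /\ Cmod (/ z) <= / m).
  { intros z Hz.
    pose proof (Cmod_triangle_minus z (z - z0)) as T.
    replace (z - (z - z0))%C with z0 in T by ring.
    assert (Hzm : m < Cmod z) by (unfold m in *; lra).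
    assert (z <> 0) by (apply Cmod_gt_0; lra).
    split; [auto |]; rewrite Cmod_inv by auto.
    apply Rinv_le_contravar; lra. }
  intros z w Hz Hw.
  destruct (Q z Hz) as [Nz Bz]; destruct (Q w Hw) as [Nw Bw].
  replace (/ z - / w - - (/ w * / w) * (z - w))%C
    with (/ z * (/ w * / w) * (z - w) ^ 2)%C by (field; auto).
  rewrite !Cmod_mult, Cmod_pow.
  apply Rmult_le_compat_r; [apply pow2_ge_0 |].
  rewrite <- pow_inv; simpl; rewrite Rmult_1_r.
  apply Rmult_le_compat; try apply Cmod_ge_0; auto.
  - apply Rmult_le_pos; apply Cmod_ge_0.
  - apply Rmult_le_compat; try apply Cmod_ge_0; auto.
Qed.

(** * Differentiation along curves and polar coordinates *)

(** The quotient-free form allows [h = 0] and combines directly with the complex remainder in the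
    chain rule. *)
Definition curve_deriv (gm : R -> C) (t : R) (l : C) : Prop :=
  forall eps, 0 < eps -> exists delta, 0 < delta /\ forall h, Rabs h < delta ->
    Cmod (gm (t + h) - gm t - l * RtoC h) <= eps * Rabs h.

Lemma curve_deriv_comp (F D : C -> C) (z0 : C) (rho K : R) (gm : R -> C) (t : R) (l : C) :
  lipschitz_chart F D z0 rho K -> Cmod (gm t - z0) < rho -> curve_deriv gm t l ->
  curve_deriv (fun s => F (gm s)) t (D (gm t) * l)%C.
Proof.
  intros (Hrho & HK & HT & HB) Hin Hgm eps He.
  set (w := gm t) in *; set (A := Cmod l + 1).
  assert (HA : 1 <= A) by (unfold A; pose proof (Cmod_ge_0 l); lra).
  (* The bound [e <= 1] gives increments of size at most [A * Rabs h]; the other bound keeps the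
     linear error below half of [eps]. Then [d2] keeps the curve inside the chart, and [d3] absorbs
     the quadratic remainder in the other half. *)
  set (e := Rmin 1 (eps / (2 * (K + 1)))).
  assert (He1 : 0 < e) by (apply Rmin_pos; [lra | apply Rdiv_lt_0_compat; lra]).
  assert (He2 : e <= 1) by apply Rmin_l.
  assert (He3 : K * e <= eps / 2).
  { assert (e <= eps / (2 * (K + 1))) by apply Rmin_r.
    assert (0 < eps / (2 * (K + 1))) by (apply Rdiv_lt_0_compat; lra).
    apply Rle_trans with ((K + 1) * (eps / (2 * (K + 1)))); [nra |].
    right; field; lra. }
  destruct (Hgm e He1) as (d & Hd & Hh).
  set (d2 := (rho - Cmod (w - z0)) / A).
  assert (Hd2 : 0 < d2) by (apply Rdiv_lt_0_compat; lra).
  set (d3 := eps / (2 * (K + 1) * A ^ 2)).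
  assert (Hd3 : 0 < d3).
  { apply Rdiv_lt_0_compat; [lra | apply Rmult_lt_0_compat; [lra | nra]]. }
  exists (Rmin d (Rmin d2 d3)); split; [repeat apply Rmin_pos; auto |].
  intros h Hhd.
  assert (M1 : Rabs h < d) by (eapply Rlt_le_trans; [apply Hhd | apply Rmin_l]).
  assert (M2 : Rabs h < d2).
  { eapply Rlt_le_trans; [apply Hhd |].
    eapply Rle_trans; [apply Rmin_r | apply Rmin_l]. }
  assert (M3 : Rabs h < d3).
  { eapply Rlt_le_trans; [apply Hhd |].
    eapply Rle_trans; [apply Rmin_r | apply Rmin_r]. }
  specialize (Hh h M1); set (z := gm (t + h)) in *; fold w in Hh.
  set (k := Rabs h) in *; assert (Hk : 0 <= k) by apply Rabs_pos.
  assert (Hzw : Cmod (z - w) <= A * k).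
  { replace (z - w)%C with ((z - w - l * RtoC h) + l * RtoC h)%C by ring.
    eapply Rle_trans; [apply Cmod_triangle |].
    rewrite Cmod_mult, Cmod_R; fold k; unfold A; nra. }
  assert (Hz : Cmod (z - z0) < rho).
  { replace (z - z0)%C with ((z - w) + (w - z0))%C by ring.
    eapply Rle_lt_trans; [apply Cmod_triangle |].
    apply (Rmult_lt_compat_l A) in M2; [| lra].
    replace (A * d2) with (rho - Cmod (w - z0)) in M2 by (unfold d2; field; lra).
    lra. }
  specialize (HT z w Hz Hin).
  destruct (HB w w Hin Hin) as (_ & BD & _).
  replace (F z - F w - D w * l * RtoC h)%C with
    ((F z - F w - D w * (z - w)) + D w * (z - w - l * RtoC h))%C by ring.
  eapply Rle_trans; [apply Cmod_triangle |]; rewrite Cmod_mult.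
  assert (Q1 : Cmod (D w) * Cmod (z - w - l * RtoC h) <= K * (e * k))
    by (apply Rmult_le_compat; auto; apply Cmod_ge_0).
  assert (Q2 : K * Cmod (z - w) ^ 2 <= K * (A * k) ^ 2).
  { apply Rmult_le_compat_l; auto; apply pow_incr; split; auto; apply Cmod_ge_0. }
  assert (Q3 : K * (A * k) ^ 2 <= eps / 2 * k).
  { replace (K * (A * k) ^ 2) with ((K * A ^ 2 * k) * k) by ring.
    apply Rmult_le_compat_r; auto.
    apply Rle_trans with ((K + 1) * A ^ 2 * d3).
    - apply Rmult_le_compat; [apply Rmult_le_pos; [lra | apply pow2_ge_0] | auto | | lra].
      apply Rmult_le_compat_r; [apply pow2_ge_0 | lra].
    - unfold d3; right; field; split; lra. }
  nra.
Qed.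

Lemma curve_deriv_is_derive (gm : R -> C) (t : R) (l : C) :
  curve_deriv gm t l ->
  is_derive (fun s => Re (gm s)) t (Re l) /\ is_derive (fun s => Im (gm s)) t (Im l).
Proof.
  intros H; split; apply is_derive_Reals; intros eps He;
    destruct (H (eps / 2)) as (d & Hd & Hh); [lra | | lra |];
    exists (mkposreal d Hd); intros h Hn Hlt; simpl in Hlt; specialize (Hh h Hlt).
  - assert (X : Rabs (Re (gm (t + h) - gm t - l * RtoC h)) <= eps / 2 * Rabs h)
      by (eapply Rle_trans; [apply re_le_Cmod | auto]).
    replace (Re (gm (t + h) - gm t - l * RtoC h))
      with (((Re (gm (t + h)) - Re (gm t)) / h - Re l) * h) in X
      by (unfold Re; simpl; field; auto).
    rewrite Rabs_mult in X; apply Rmult_le_reg_r in X; [lra | now apply Rabs_pos_lt].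
  - assert (X : Rabs (Im (gm (t + h) - gm t - l * RtoC h)) <= eps / 2 * Rabs h)
      by (eapply Rle_trans; [apply im_le_Cmod | auto]).
    replace (Im (gm (t + h) - gm t - l * RtoC h))
      with (((Im (gm (t + h)) - Im (gm t)) / h - Im l) * h) in X
      by (unfold Im; simpl; field; auto).
    rewrite Rabs_mult in X; apply Rmult_le_reg_r in X; [lra | now apply Rabs_pos_lt].
Qed.

Lemma is_derive_curve_deriv (gm : R -> C) (t : R) (l : C) :
  is_derive (fun s => Re (gm s)) t (Re l) -> is_derive (fun s => Im (gm s)) t (Im l) ->
  curve_deriv gm t l.
Proof.
  intros H1 H2 eps He; apply is_derive_Reals in H1; apply is_derive_Reals in H2.
  destruct (H1 (eps / 2)) as [d1 D1]; [lra |].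
  destruct (H2 (eps / 2)) as [d2 D2]; [lra |].
  exists (Rmin d1 d2); split; [apply Rmin_pos; apply cond_pos |]; intros h Hh.
  assert (M1 : Rabs h < d1) by (eapply Rlt_le_trans; [apply Hh | apply Rmin_l]).
  assert (M2 : Rabs h < d2) by (eapply Rlt_le_trans; [apply Hh | apply Rmin_r]).
  destruct (Req_dec h 0) as [-> | Hn].
  { rewrite Rplus_0_r, Rabs_R0.
    replace (gm t - gm t - l * RtoC 0)%C with (RtoC 0) by ring; rewrite Cmod_0; lra. }
  specialize (D1 h Hn M1); specialize (D2 h Hn M2).
  eapply Rle_trans; [apply Cmod_le_abs |].
  replace (Re (gm (t + h) - gm t - l * RtoC h))
    with (((Re (gm (t + h)) - Re (gm t)) / h - Re l) * h)
    by (unfold Re; simpl; field; auto).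
  replace (Im (gm (t + h) - gm t - l * RtoC h))
    with (((Im (gm (t + h)) - Im (gm t)) / h - Im l) * h)
    by (unfold Im; simpl; field; auto).
  rewrite !Rabs_mult; pose proof (Rabs_pos h); nra.
Qed.

(** Written with [Cexp] so that it is convertible with the parametrisation inside
    [circle_integral]. *)
Definition cis (t : R) : C := Cexp (Ci * RtoC t).

Lemma cis_eq (t : R) : cis t = (cos t, sin t).
Proof.
  unfold cis, Cexp; simpl.
  replace (0 * t - 1 * 0) with 0 by ring; replace (0 * 0 + 1 * t) with t by ring.
  rewrite exp_0; apply injective_projections; simpl; ring.
Qed.

Lemma Cmod_cis (t : R) : Cmod (cis t) = 1.
Proof.
  rewrite cis_eq; unfold Cmod; simpl fst; simpl snd.
  replace (cos t ^ 2 + sin t ^ 2) with 1; [apply sqrt_1 |].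
  pose proof (sin2_cos2 t); unfold Rsqr in *; lra.
Qed.

Lemma Cmod_polar (r t : R) : 0 <= r -> Cmod (RtoC r * cis t) = r.
Proof.
  intros H; rewrite Cmod_mult, Cmod_cis, Cmod_R, Rabs_pos_eq; lra.
Qed.

Lemma cis_deriv (r t : R) :
  curve_deriv (fun s => RtoC r * cis s)%C t (RtoC r * (Ci * cis t))%C.
Proof.
  replace (fun s => RtoC r * cis s)%C with (fun s => (r * cos s, r * sin s) : C).
  2: { apply functional_extensionality; intros s; rewrite cis_eq.
       apply injective_projections; simpl; ring. }
  rewrite cis_eq; apply is_derive_curve_deriv; unfold Re, Im; simpl;
    auto_derive; auto; ring.
Qed.

Lemma radial_deriv (r t : R) :
  curve_deriv (fun s => RtoC s * cis t)%C r (cis t).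
Proof.
  intros eps He; exists 1; split; [lra |]; intros h _.
  rewrite RtoC_plus.
  replace ((RtoC r + RtoC h) * cis t - RtoC r * cis t - cis t * RtoC h)%C
    with (RtoC 0) by ring.
  rewrite Cmod_0; apply Rmult_le_pos; [lra | apply Rabs_pos].
Qed.

Lemma cis_lipschitz (s t : R) : Cmod (cis s - cis t) <= 2 * Rabs (s - t).
Proof.
  eapply Rle_trans; [apply Cmod_le_abs |].
  rewrite !cis_eq.
  change (Re ((cos s, sin s) - (cos t, sin t))%C) with (cos s - cos t).
  change (Im ((cos s, sin s) - (cos t, sin t))%C) with (sin s - sin t).
  assert (Rabs (cos s - cos t) <= 1 * Rabs (s - t)).
  { apply (bounded_variation cos (fun x => - sin x)); intros x _; split.
    - apply is_derive_Reals, derivable_pt_lim_cos.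
    - rewrite Rabs_Ropp; apply Rabs_le, SIN_bound. }
  assert (Rabs (sin s - sin t) <= 1 * Rabs (s - t)).
  { apply (bounded_variation sin cos); intros x _; split.
    - apply is_derive_Reals, derivable_pt_lim_sin.
    - apply Rabs_le, COS_bound. }
  lra.
Qed.

Lemma polar_near (x t u v e : R) :
  Rabs (u - x) < e -> Rabs (v - t) < e ->
  Cmod (RtoC u * cis v - RtoC x * cis t) <= (1 + 2 * Rabs x) * e.
Proof.
  intros Hu Hv.
  replace (RtoC u * cis v - RtoC x * cis t)%C with
    (RtoC (u - x) * cis v + RtoC x * (cis v - cis t))%C
    by (rewrite RtoC_minus; ring).
  eapply Rle_trans; [apply Cmod_triangle |].
  rewrite !Cmod_mult, Cmod_cis, !Cmod_R.
  pose proof (cis_lipschitz v t); pose proof (Rabs_pos x).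
  assert (Rabs x * Cmod (cis v - cis t) <= Rabs x * (2 * e))
    by (apply Rmult_le_compat_l; lra).
  lra.
Qed.

(* The second and third claims relate the radial derivative of the real part to
   the angular derivative of the imaginary part (Cauchy-Riemann equation). *)
Lemma holo_polar_derive (F : C -> C) (x t : R) :
  holo_at F (RtoC x * cis t)%C ->
  exists d : R -> R -> R,
    locally_2d (fun u v =>
       is_derive (fun s => Re (F (RtoC s * cis v)%C)) u (d u v) /\
       is_derive (fun s => Im (F (RtoC u * cis s)%C)) v (u * d u v) /\
       ex_derive (fun s => Re (F (RtoC u * cis s)%C)) v) x t /\
    continuity_2d_pt d x t.
Proof.
  intros H; apply holo_at_chart in H; destruct H as (rho & K & D & HC).
  exists (fun u v => Re (D (RtoC u * cis v) * cis v)%C).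
  pose proof HC as (Hrho & HK & HT & HB).
  set (A := 1 + 2 * Rabs x).
  assert (HA : 1 <= A) by (unfold A; pose proof (Rabs_pos x); lra).
  (* [polar_near] loses the factor [A] from polar to Cartesian distance; the 2 makes the inclusion
     strict. *)
  set (e0 := rho / (2 * A)).
  assert (He0 : 0 < e0) by (apply Rdiv_lt_0_compat; lra).
  assert (near : forall u v, Rabs (u - x) < e0 -> Rabs (v - t) < e0 ->
             Cmod (RtoC u * cis v - RtoC x * cis t) < rho).
  { intros u v Hu Hv; eapply Rle_lt_trans; [apply (polar_near _ _ _ _ _ Hu Hv) |].
    fold A; unfold e0; replace (A * (rho / (2 * A))) with (rho / 2) by (field; lra).
    lra. }
  split.
  - exists (mkposreal e0 He0); simpl; intros u v Hu Hv.
    specialize (near u v Hu Hv).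
    destruct (curve_deriv_is_derive (fun s => F (RtoC u * cis s)%C) v
      (D (RtoC u * cis v) * (RtoC u * (Ci * cis v)))%C) as [R1 R2].
    { apply (curve_deriv_comp F D _ rho K (fun s => RtoC u * cis s)%C _ _ HC near).
      apply cis_deriv. }
    set (q := D (RtoC u * cis v)%C) in *.
    split; [| split].
    + destruct (curve_deriv_is_derive (fun s => F (RtoC s * cis v)%C) u (q * cis v)%C)
        as [R3 _]; [| exact R3].
      apply (curve_deriv_comp F D _ rho K (fun s => RtoC s * cis v)%C _ _ HC near).
      apply radial_deriv.
    + change (is_derive (fun s => Im (F (RtoC u * cis s)%C)) v (u * Re (q * cis v)%C)).
      (* The angular velocity is [Ci * u] times the radial one, and [Im (Ci * z) = Re z]. *)
      replace (u * Re (q * cis v)%C) with (Im (q * (RtoC u * (Ci * cis v)))%C);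
        [exact R2 | unfold Re, Im; simpl; ring].
    + eexists; apply R1.
  - intros [eps He]; simpl; set (B := K * A + K * 2 + 1).
    assert (HB1 : 1 <= B) by (unfold B; nra).
    assert (Hm : 0 < Rmin e0 (eps / (2 * B)))
      by (apply Rmin_pos; auto; apply Rdiv_lt_0_compat; lra).
    exists (mkposreal _ Hm); simpl.
    intros u v Hu Hv.
    set (e1 := Rmin e0 (eps / (2 * B))) in *.
    assert (E1 : e1 <= e0) by apply Rmin_l.
    assert (E2 : e1 <= eps / (2 * B)) by apply Rmin_r.
    assert (N1 := near u v ltac:(lra) ltac:(lra)).
    assert (N0 : Cmod (RtoC x * cis t - RtoC x * cis t) < rho).
    { replace (RtoC x * cis t - RtoC x * cis t)%C with (RtoC 0) by ring.
      now rewrite Cmod_0. }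
    destruct (HB _ _ N1 N0) as (_ & B1 & _ & B2).
    destruct (HB _ _ N0 N0) as (_ & B3 & _).
    set (p := (RtoC u * cis v)%C) in *; set (q := (RtoC x * cis t)%C) in *.
    eapply Rle_lt_trans;
      [apply (re_le_Cmod (D p * cis v - D q * cis t)%C) |].
    replace (D p * cis v - D q * cis t)%C with
      ((D p - D q) * cis v + D q * (cis v - cis t))%C by ring.
    eapply Rle_lt_trans; [apply Cmod_triangle |].
    rewrite !Cmod_mult, Cmod_cis.
    pose proof (polar_near x t u v e1 Hu Hv) as P; fold p q A in P.
    pose proof (cis_lipschitz v t) as L.
    assert (0 <= e1) by (pose proof (Rabs_pos (u - x)); lra).
    assert (Cmod (D q) * Cmod (cis v - cis t) <= K * (2 * e1))
      by (apply Rmult_le_compat; try apply Cmod_ge_0; lra).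
    assert (K * Cmod (p - q) <= K * (A * e1)) by (apply Rmult_le_compat_l; auto).
    assert (B * e1 <= eps / 2).
    { apply Rle_trans with (B * (eps / (2 * B))); [apply Rmult_le_compat_l; lra |].
      right; field; lra. }
    unfold B in *; nra.
Qed.

(** * Circle integrals and the Cauchy estimate *)

(** Real parts suffice, since an imaginary part is the real part after multiplication by [- Ci]. The
    origin is excluded because the integrand defining [u_d] may have a pole there. *)
Lemma circle_Re_const (F : C -> C) (rmax r1 r2 : R) :
  (forall z, 0 < Cmod z < rmax -> holo_at F z) ->
  0 < r1 < rmax -> 0 < r2 < rmax ->
  RInt (fun t => Re (F (RtoC r1 * cis t)%C)) 0 (2 * PI) =
  RInt (fun t => Re (F (RtoC r2 * cis t)%C)) 0 (2 * PI).
Proof.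
  intros HF.
  set (f := fun u t => Re (F (RtoC u * cis t)%C)).
  set (I := fun u => RInt (fun t => f u t) 0 (2 * PI)).
  assert (Hpol : forall x t, 0 < x < rmax -> holo_at F (RtoC x * cis t)%C).
  { intros x t Hx; apply HF; rewrite Cmod_polar; lra. }
  assert (Hdiff : forall x t, 0 < x < rmax ->
     is_derive (fun u => f u t) x (Derive (fun u => f u t) x) /\
     is_derive (fun s => Im (F (RtoC x * cis s)%C)) t (x * Derive (fun u => f u t) x) /\
     ex_derive (f x) t /\
     continuity_2d_pt (fun u v => Derive (fun z => f z v) u) x t).
  { intros x t Hx; destruct (holo_polar_derive F x t (Hpol x t Hx)) as (d & Hd & Hc).
    destruct (locally_2d_singleton _ _ _ Hd) as (D1 & D2 & D3).
    assert (E : Derive (fun u => f u t) x = d x t) by now apply is_derive_unique.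
    rewrite E; split; [exact D1 | split; [exact D2 | split; [exact D3 |]]].
    apply continuity_2d_pt_ext_loc with d; auto.
    destruct Hd as [dl Hd]; exists dl; intros u v Hu Hv.
    symmetry; apply is_derive_unique; now apply (Hd u v). }
  assert (Hloc : forall x, 0 < x < rmax -> locally x (fun y => 0 < y < rmax)).
  { intros x [Hx1 Hx2]; apply filter_and; [now apply open_gt | now apply open_lt]. }
  assert (HI : forall x, 0 < x < rmax -> is_derive I x 0).
  { intros x Hx.
    (* [x] times this integrand is the angular derivative of [Im (F _)]. Its integral is a
       difference of values at the angles [2 * PI] and [0], which are the same point. *)
    assert (E : RInt (fun t => Derive (fun u => f u t) x) 0 (2 * PI) = 0).
    { apply is_RInt_unique.
      assert (P : is_RInt (fun t => x * Derive (fun u => f u t) x) 0 (2 * PI)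
                    (minus (Im (F (RtoC x * cis (2 * PI))%C))
                           (Im (F (RtoC x * cis 0)%C)))).
      { apply (@is_RInt_derive R_CompleteNormedModule
                 (fun s => Im (F (RtoC x * cis s)%C))).
        - intros t _; exact (proj1 (proj2 (Hdiff x t Hx))).
        - intros t _.
          apply (continuous_scal_r x (fun t => Derive (fun u => f u t) x)).
          destruct (Hdiff x t Hx) as (_ & _ & _ & Hc).
          apply continuity_pt_filterlim.
          intros eps He; destruct (Hc (mkposreal eps He)) as [dl Hdl].
          exists dl; split; [apply cond_pos |].
          intros s [_ Hs]; apply Hdl; auto.
          rewrite Rminus_diag, Rabs_R0; apply cond_pos. }
      rewrite !cis_eq, cos_2PI, sin_2PI, cos_0, sin_0 in P.
      apply (@is_RInt_scal R_NormedModule _ _ _ (/ x)) in P.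
      replace (scal (/ x) _) with 0 in P
        by (unfold scal, minus, plus, opp; simpl; unfold mult; simpl; ring).
      revert P; apply is_RInt_ext; intros t _.
      unfold scal; simpl; unfold mult; simpl; field; lra. }
    rewrite <- E; apply is_derive_RInt_param.
    - generalize (Hloc x Hx); apply filter_imp; intros y Hy t _.
      eexists; exact (proj1 (Hdiff y t Hy)).
    - intros t _; apply (Hdiff x t Hx).
    - generalize (Hloc x Hx); apply filter_imp; intros y Hy.
      apply (@ex_RInt_continuous R_CompleteNormedModule); intros t _.
      apply (ex_derive_continuous (f y)), (Hdiff y t Hy). }
  assert (Hlt : forall a b, 0 < a < rmax -> 0 < b < rmax -> a < b -> I a = I b).
  { intros a b Ha Hb Hab; apply (@eq_is_derive R_NormedModule); auto.
    intros t Ht; apply HI; lra. }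
  intros H1 H2; change (I r1 = I r2).
  destruct (Rtotal_order r1 r2) as [H | [-> | H]]; auto.
  symmetry; auto.
Qed.

Lemma continuous_circle_parts (F : C -> C) (r t : R) :
  holo_at F (RtoC r * cis t)%C ->
  continuous (fun s => Re (F (RtoC r * cis s)%C)) t /\
  continuous (fun s => Im (F (RtoC r * cis s)%C)) t.
Proof.
  intros H; destruct (holo_polar_derive F r t H) as (d & Hd & _).
  destruct (locally_2d_singleton _ _ _ Hd) as (_ & D2 & D3).
  split.
  - now apply (ex_derive_continuous (fun s => Re (F (RtoC r * cis s)%C))).
  - apply (ex_derive_continuous (fun s => Im (F (RtoC r * cis s)%C))); eexists; apply D2.
Qed.

Lemma is_RInt_circle (F : C -> C) (r : R) :
  (forall t, holo_at F (RtoC r * cis t)%C) ->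
  @is_RInt C_R_NormedModule (fun t => F (RtoC r * cis t)%C) 0 (2 * PI)
    (RInt (fun t => Re (F (RtoC r * cis t)%C)) 0 (2 * PI),
     RInt (fun t => Im (F (RtoC r * cis t)%C)) 0 (2 * PI)).
Proof.
  intros H; apply (@is_RInt_fct_extend_pair R_NormedModule R_NormedModule);
    apply (@RInt_correct R_CompleteNormedModule), ex_RInt_continuous;
    intros t _; now apply continuous_circle_parts.
Qed.

(** [RInt] is total; holomorphy on the circle provides the integrability that makes its value
    meaningful and computable by components. *)
Lemma circle_integral_eq (f : C -> C) (r : R) :
  (forall t, holo_at (fun z => f z * (Ci * z))%C (RtoC r * cis t)%C) ->
  circle_integral f r =
    (RInt (fun t => Re (f (RtoC r * cis t) * (Ci * (RtoC r * cis t)))%C) 0 (2 * PI),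
     RInt (fun t => Im (f (RtoC r * cis t) * (Ci * (RtoC r * cis t)))%C) 0 (2 * PI)).
Proof.
  intros H; apply (@is_RInt_unique C_R_CompleteNormedModule),
    (is_RInt_circle (fun z => f z * (Ci * z))%C), H.
Qed.

Lemma circle_integral_const (f : C -> C) (rmax r1 r2 : R) :
  (forall z, 0 < Cmod z < rmax -> holo_at f z) ->
  0 < r1 < rmax -> 0 < r2 < rmax ->
  circle_integral f r1 = circle_integral f r2.
Proof.
  intros Hf H1 H2; set (F := fun z => (f z * (Ci * z))%C).
  assert (HF : forall z, 0 < Cmod z < rmax -> holo_at F z).
  { intros z Hz; apply (holo_at_mult f (fun z => Ci * z)%C); auto.
    apply (holo_at_mult (fun _ => Ci)); [apply holo_at_const | apply holo_at_id]. }
  assert (Hp : forall r t, 0 < r < rmax -> holo_at F (RtoC r * cis t)%C).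
  { intros r t Hr; apply HF; rewrite Cmod_polar; lra. }
  rewrite !circle_integral_eq by (intros; apply Hp; auto).
  f_equal.
  - now apply (circle_Re_const F rmax).
  - assert (E : forall z, Im z = Re (- Ci * z)%C)
      by (intros [a b]; unfold Re, Im; simpl; ring).
    rewrite !(RInt_ext (fun t => Im _) _ _ _ (fun t _ => E _)).
    apply (circle_Re_const (fun z => - Ci * F z)%C rmax); auto.
    intros z Hz; apply (holo_at_mult (fun _ => - Ci)%C); auto; apply holo_at_const.
Qed.

Lemma circle_integral_le (f : C -> C) (r M : R) :
  0 < r -> (forall z, Cmod z = r -> holo_at f z) ->
  (forall z, Cmod z = r -> Cmod (f z) <= M) ->
  Cmod (circle_integral f r) <= 2 * PI * (M * r).
Proof.
  intros Hr Hf HM.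
  assert (Hp : forall t, holo_at (fun z => f z * (Ci * z))%C (RtoC r * cis t)%C).
  { intros t; apply (holo_at_mult f (fun z => Ci * z)%C).
    - apply Hf, Cmod_polar; lra.
    - apply (holo_at_mult (fun _ => Ci)); [apply holo_at_const | apply holo_at_id]. }
  rewrite circle_integral_eq, Cmod_norm by apply Hp.
  refine (@norm_RInt_le C_R_NormedModule _ (fun _ => M * r) 0 (2 * PI) _ _ _ _
            (is_RInt_circle _ _ Hp) _).
  - pose proof PI_RGT_0; lra.
  - intros t _.
    rewrite <- Cmod_norm, Cmod_mult, (Cmod_mult Ci), Cmod_Ci, Rmult_1_l, (Cmod_polar r t) by lra.
    apply Rmult_le_compat_r; [lra |]; apply HM, Cmod_polar; lra.
  - replace (2 * PI * (M * r)) with (scal (2 * PI - 0) (M * r))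
      by (unfold scal; simpl; unfold mult; simpl; ring).
    apply (@is_RInt_const R_NormedModule).
Qed.

(** Makes the circle the image of a compact interval, so that the extreme value theorem on
    [[0, 2 * PI]] yields the maximum in [Cmod_circle_max]. *)
Lemma polar_form (z : C) (r : R) :
  0 < r -> Cmod z = r -> exists t, 0 <= t <= 2 * PI /\ z = (RtoC r * cis t)%C.
Proof.
  intros Hr Hz; destruct z as [a b].
  assert (Hab : a ^ 2 + b ^ 2 = r ^ 2).
  { rewrite <- Hz, Cmod2_alt; reflexivity. }
  assert (Ha : -1 <= a / r <= 1).
  { split; [apply Rmult_le_reg_r with r | apply Rmult_le_reg_r with r]; auto;
      replace (a / r * r) with a by (field; lra); nra. }
  pose proof (acos_bound (a / r)) as Hb.
  assert (Hc : cos (acos (a / r)) = a / r) by now apply cos_acos.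
  assert (Hs : r * sin (acos (a / r)) = Rabs b).
  { rewrite sin_acos by auto.
    rewrite <- (sqrt_Rsqr r) at 1 by lra.
    rewrite <- sqrt_mult_alt by apply Rle_0_sqr.
    rewrite <- sqrt_Rsqr_abs; f_equal; unfold Rsqr.
    replace (r * r * (1 - a / r * (a / r))) with (r ^ 2 - a ^ 2) by (field; lra).
    lra. }
  destruct (Rle_lt_dec 0 b) as [Hb0 | Hb0].
  - exists (acos (a / r)); split; [lra |]; rewrite cis_eq.
    rewrite Rabs_pos_eq in Hs by auto.
    apply injective_projections; simpl; rewrite ?Hc; [field; lra | lra].
  (* [acos] only reaches the upper half circle; the reflected angle is shifted by a period to stay
     in the interval. *)
  - exists (- acos (a / r) + 2 * PI); split; [lra |]; rewrite cis_eq.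
    rewrite Rabs_left in Hs by auto.
    replace (2 * PI) with (2 * INR 1 * PI) by (simpl; ring).
    rewrite cos_period, sin_period, cos_neg, sin_neg.
    apply injective_projections; simpl; rewrite ?Hc; [field; lra | lra].
Qed.

Lemma Cmod_circle_max (F : C -> C) (r : R) :
  0 < r -> (forall z, Cmod z = r -> holo_at F z) ->
  exists M, max_on_circle (fun z => Cmod (F z)) r M.
Proof.
  intros Hr HF.
  destruct (continuity_ab_maj (fun t => Cmod (F (RtoC r * cis t)%C)) 0 (2 * PI))
    as (tm & Hmax & Htm).
  - pose proof PI_RGT_0; lra.
  - intros t _.
    destruct (continuous_circle_parts F r t) as [C1 C2].
    { apply HF, Cmod_polar; lra. }
    apply continuity_pt_filterlim in C1; apply continuity_pt_filterlim in C2.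
    unfold Cmod.
    apply (continuity_pt_comp
      (fun s => Re (F (RtoC r * cis s)%C) ^ 2 + Im (F (RtoC r * cis s)%C) ^ 2) sqrt).
    + apply (continuity_pt_plus
        (fun s => Re (F (RtoC r * cis s)%C) ^ 2) (fun s => Im (F (RtoC r * cis s)%C) ^ 2)).
      * apply (continuity_pt_comp (fun s => Re (F (RtoC r * cis s)%C)) (fun x => x ^ 2));
          [auto | apply derivable_continuous_pt, derivable_pt_pow].
      * apply (continuity_pt_comp (fun s => Im (F (RtoC r * cis s)%C)) (fun x => x ^ 2));
          [auto | apply derivable_continuous_pt, derivable_pt_pow].
    + apply continuity_pt_sqrt.
      pose proof (pow2_ge_0 (Re (F (RtoC r * cis t)%C)));
      pose proof (pow2_ge_0 (Im (F (RtoC r * cis t)%C))); lra.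
  - exists (Cmod (F (RtoC r * cis tm)%C)); split.
    + exists (RtoC r * cis tm)%C; split; [apply Cmod_polar; lra | reflexivity].
    + intros z Hz; destruct (polar_form z r Hr Hz) as (t & Ht & ->); auto.
Qed.

Lemma cauchy_coefficient_bound (F : C -> C) (rmax r1 r2 M : R) (n : nat) :
  (forall z, Cmod z < rmax -> holo_at F z) ->
  0 < r1 < rmax -> 0 < r2 < rmax ->
  (forall z, Cmod z = r2 -> Cmod (F z) <= M) ->
  Cmod (/ (2 * RtoC PI * Ci) * circle_integral (fun z => F z / z ^ S n)%C r1)
    <= M * / r2 ^ n.
Proof.
  intros HF H1 H2 HM.
  assert (Hf : forall z, 0 < Cmod z < rmax -> holo_at (fun z => F z / z ^ S n)%C z).
  { intros z Hz; apply (holo_at_mult F (fun z => / z ^ S n)%C); [apply HF; lra |].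
    (* The two integrands must agree as functions on all of [C], hence also at 0, where the total
       inverse takes the value 0. *)
    assert (Hi : Cinv 0 = 0).
    { apply injective_projections; simpl; unfold Rdiv; ring. }
    replace (fun z => / z ^ S n)%C with (fun z => (/ z) ^ S n)%C.
    - apply (holo_at_pow Cinv), holo_at_inv, Cmod_gt_0; lra.
    - apply functional_extensionality; intros w.
      destruct (Ceq_dec w 0) as [-> | Hw]; [| now apply Cpow_inv].
      rewrite !Cpow_S, Cmult_0_l, Hi; ring. }
  pose proof PI_RGT_0 as HPI.
  assert (Hr : 0 < r2 ^ n) by (apply pow_lt; lra).
  rewrite (circle_integral_const _ rmax r1 r2 Hf H1 H2).
  assert (B : Cmod (circle_integral (fun z => F z / z ^ S n)%C r2)
              <= 2 * PI * (M / r2 ^ S n * r2)).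
  { apply circle_integral_le; [lra | |].
    - intros z Hz; apply Hf; lra.
    - intros z Hz.
      rewrite Cmod_div, Cmod_pow, Hz by (apply Cpow_nz, Cmod_gt_0; lra).
      apply Rmult_le_compat_r; [| auto].
      left; apply Rinv_0_lt_compat, pow_lt; lra. }
  assert (HP : Cmod (2 * RtoC PI * Ci) = 2 * PI).
  { rewrite !Cmod_mult, Cmod_Ci, !Cmod_R, !Rabs_pos_eq; lra. }
  rewrite Cmod_mult, Cmod_inv, HP by (apply Cmod_gt_0; rewrite HP; lra).
  apply Rmult_le_reg_l with (2 * PI); [lra |].
  rewrite <- Rmult_assoc, Rinv_r, Rmult_1_l by lra.
  eapply Rle_trans; [apply B |]; right; simpl; field; lra.
Qed.

(** * Continuity within a set, and homogeneity of the solution operator *)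

(** Neighbourhoods in [C] are those of the product; [Cmod] is at most the sum of the component
    moduli, hence [eps / 2] in one direction. *)
Lemma continuous_within_iff (A : R3 -> Prop) (f : R3 -> C) :
  continuous_within A f <->
  forall x, A x -> forall eps, 0 < eps ->
    locally x (fun y => A y -> Cmod (f y - f x) < eps).
Proof.
  split; intros H x Hx.
  - intros eps He.
    pose proof (proj1 (filterlim_locally _ _) (H x Hx) (mkposreal (eps / 2) ltac:(lra))) as L.
    unfold within in L; revert L; apply filter_imp; intros y L Hy; destruct (L Hy) as [L1 L2].
    change (Rabs (Re (f y) - Re (f x)) < eps / 2) in L1.
    change (Rabs (Im (f y) - Im (f x)) < eps / 2) in L2.
    eapply Rle_lt_trans; [apply Cmod_le_abs |].
    change (Re (f y - f x)%C) with (Re (f y) - Re (f x)).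
    change (Im (f y - f x)%C) with (Im (f y) - Im (f x)); lra.
  - apply filterlim_locally; intros [eps He]; unfold within.
    generalize (H x Hx eps He); apply filter_imp; intros y L Hy; specialize (L Hy).
    split.
    + change (Rabs (Re (f y - f x)%C) < eps).
      eapply Rle_lt_trans; [apply re_le_Cmod | auto].
    + change (Rabs (Im (f y - f x)%C) < eps).
      eapply Rle_lt_trans; [apply im_le_Cmod | auto].
Qed.

Lemma continuous_within_ext (A : R3 -> Prop) (f g : R3 -> C) :
  (forall x, A x -> f x = g x) -> continuous_within A f -> continuous_within A g.
Proof.
  rewrite !continuous_within_iff; intros E H x Hx eps He.
  generalize (H x Hx eps He); apply filter_imp; intros y L Hy.
  rewrite <- !E by auto; auto.
Qed.

Lemma continuous_within_lin (A : R3 -> Prop) (a : C) (f g : R3 -> C) :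
  continuous_within A f -> continuous_within A g ->
  continuous_within A (fun y => a * f y + g y)%C.
Proof.
  rewrite !continuous_within_iff; intros Hf Hg x Hx eps He.
  pose proof (Cmod_ge_0 a) as Ha.
  assert (Hp : 0 < eps / (2 * (Cmod a + 1))) by (apply Rdiv_lt_0_compat; lra).
  generalize (filter_and _ _ (Hf x Hx _ Hp) (Hg x Hx (eps / 2) ltac:(lra))).
  apply filter_imp; intros y [L1 L2] Hy; specialize (L1 Hy); specialize (L2 Hy).
  replace (a * f y + g y - (a * f x + g x))%C
    with (a * (f y - f x) + (g y - g x))%C by ring.
  eapply Rle_lt_trans; [apply Cmod_triangle |]; rewrite Cmod_mult.
  apply (Rmult_lt_compat_l (Cmod a + 1)) in L1; [| lra].
  replace ((Cmod a + 1) * (eps / (2 * (Cmod a + 1)))) with (eps / 2) in L1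
    by (field; lra).
  pose proof (Cmod_ge_0 (f y - f x)); lra.
Qed.

Lemma continuous_within_const (A : R3 -> Prop) (a : C) : continuous_within A (fun _ => a).
Proof.
  apply continuous_within_iff; intros x Hx eps He; apply filter_forall; intros y _.
  replace (a - a)%C with (RtoC 0) by ring; now rewrite Cmod_0.
Qed.

Lemma continuous_within_scal (A : R3 -> Prop) (a : C) (f : R3 -> C) :
  continuous_within A f -> continuous_within A (fun y => a * f y)%C.
Proof.
  intros H; apply continuous_within_ext with (fun y => a * f y + 0)%C.
  - intros; ring.
  - apply (continuous_within_lin A a f (fun _ => 0%C)); auto; apply continuous_within_const.
Qed.

Lemma continuous_within_Csum (A : R3 -> Prop) (c : nat -> R3 -> C) (w : nat -> C) n :
  (forall m, continuous_within A (c m)) ->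
  continuous_within A (fun y => Csum (fun m => w m * c m y)%C n).
Proof.
  intros H; induction n as [|n IH].
  - apply continuous_within_ext with (fun y => w 0%nat * c 0%nat y)%C.
    + intros; now rewrite Csum_O.
    + now apply continuous_within_scal.
  - apply continuous_within_ext
      with (fun y => w (S n) * c (S n) y + Csum (fun m => w m * c m y)%C n)%C.
    + intros; rewrite Csum_S; ring.
    + now apply continuous_within_lin.
Qed.

(** For a real factor [Derive_scal] needs no differentiability. This is therefore an equality of
    functions, usable under a second [ddir] in the Laplacian. *)
Lemma ddir_scal (a : R) (e : R3) (f : R3 -> C) :
  ddir e (fun y => RtoC a * f y)%C = (fun x => RtoC a * ddir e f x)%C.
Proof.
  apply functional_extensionality; intros x; unfold ddir.
  apply injective_projections; simpl fst.
  - rewrite (Derive_ext _ (fun t => a * Re (along f x e t)))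
      by (intros t; unfold along, Re; simpl; ring).
    rewrite Derive_scal; simpl; ring.
  - simpl snd; rewrite (Derive_ext _ (fun t => a * Im (along f x e t)))
      by (intros t; unfold along, Im; simpl; ring).
    rewrite Derive_scal; simpl; ring.
Qed.

Lemma C1_on_scal (a : R) (A : R3 -> Prop) (f : R3 -> C) :
  C1_on A f -> C1_on A (fun y => RtoC a * f y)%C.
Proof.
  intros H e; destruct (H e) as [H1 H2]; split.
  - intros x Hx; destruct (H1 x Hx) as [D1 D2]; split.
    + apply ex_derive_ext with (fun t => a * Re (along f x e t)).
      * intros t; unfold along, Re; simpl; ring.
      * now apply ex_derive_scal.
    + apply ex_derive_ext with (fun t => a * Im (along f x e t)).
      * intros t; unfold along, Im; simpl; ring.
      * now apply ex_derive_scal.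
  - rewrite ddir_scal; now apply continuous_within_scal.
Qed.

Lemma outgoing_scal (Om : R3 -> Prop) (k : C) (a : R) (v : R3 -> C) :
  outgoing Om k v -> outgoing Om k (fun y => RtoC a * v y)%C.
Proof.
  intros (r0 & Hr0 & Hin & co & H).
  exists r0; split; [auto |]; split; [auto |].
  exists (fun n m => RtoC a * co n m)%C; intros x Hx; specialize (H x Hx).
  apply (is_series_scal a) in H.
  replace (RtoC a * v x)%C with (@scal R_AbsRing C_R_NormedModule a (v x)).
  2: { apply injective_projections; unfold scal; simpl; unfold scal; simpl;
         unfold mult; simpl; ring. }
  revert H; apply is_series_ext; intros n.
  set (q := fun j => _); set (q' := fun j => _).
  assert (E : Csum q' (2 * n) = (RtoC a * Csum q (2 * n))%C).
  { rewrite <- Csum_scal; apply Csum_ext; intros j; unfold q, q'; ring. }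
  rewrite E; apply injective_projections; unfold scal; simpl; unfold scal; simpl;
    unfold mult; simpl; ring.
Qed.

Lemma outgoing_solution_scal (Om : R3 -> Prop) (k : C) (a : R) (g v : R3 -> C) :
  outgoing_solution Om k g v ->
  outgoing_solution Om k (fun y => RtoC a * g y)%C (fun y => RtoC a * v y)%C.
Proof.
  intros ((H1 & H1') & H2 & H3 & H4 & H5); split; [split |].
  - now apply C1_on_scal.
  - intros e; rewrite ddir_scal; now apply C1_on_scal.
  - split; [now apply continuous_within_scal |]; split; [| split].
    + intros x Hx; unfold laplacian; rewrite !ddir_scal.
      specialize (H3 x Hx); unfold laplacian in H3.
      transitivity (RtoC a * 0)%C; [rewrite <- H3 |]; ring.
    + intros y Hy; now rewrite H4.
    + now apply outgoing_scal.
Qed.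

(** The multiple of a solution solves the problem with the multiplied data, and outgoing solutions
    are unique. *)
Lemma solution_operator_scal (Om : R3 -> Prop) (k : C) (T : operator) (a : R)
  (g : R3 -> C) (x : R3) :
  solution_operator Om k T -> data Om g -> exterior Om x ->
  T (fun y => RtoC a * g y)%C x = (RtoC a * T g x)%C.
Proof.
  intros HT Hg Hx.
  assert (Hag : data Om (fun y => RtoC a * g y)%C) by now apply continuous_within_scal.
  symmetry; apply (proj2 (HT _ Hag) (fun y => RtoC a * T g y)%C); auto.
  apply outgoing_solution_scal, HT, Hg.
Qed.

(** * Boundedness of boundary data by compactness *)

Lemma coord_le_enorm (x1 x2 x3 : R) :
  Rabs x1 <= enorm (x1, x2, x3) /\ Rabs x2 <= enorm (x1, x2, x3) /\
  Rabs x3 <= enorm (x1, x2, x3).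
Proof.
  unfold enorm; rewrite <- !sqrt_Rsqr_abs; unfold Rsqr.
  repeat split; apply sqrt_le_1_alt; nra.
Qed.

Lemma locally_cube (x1 x2 x3 : R) (P : R3 -> Prop) :
  locally (x1, x2, x3) P <->
  exists d : posreal, forall y1 y2 y3, Rabs (y1 - x1) < d -> Rabs (y2 - x2) < d ->
    Rabs (y3 - x3) < d -> P (y1, y2, y3).
Proof.
  split; intros [d H]; exists d.
  - intros y1 y2 y3 H1 H2 H3; apply H; repeat split; auto.
  - intros [[y1 y2] y3] [[H1 H2] H3]; apply H; auto.
Qed.

Lemma boundary_bounded (Om : R3 -> Prop) :
  bounded_set Om -> exists M, forall x1 x2 x3, boundary Om (x1, x2, x3) ->
    Rabs x1 <= M /\ Rabs x2 <= M /\ Rabs x3 <= M.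
Proof.
  (* A boundary point has points of [Om] within coordinate distance 1. *)
  intros [M HM]; exists (M + 1); intros x1 x2 x3 [Hc _].
  apply NNPP; intros Hn; apply Hc, locally_cube.
  exists (mkposreal 1 Rlt_0_1); simpl; intros y1 y2 y3 H1 H2 H3 Hy; apply Hn.
  specialize (HM _ Hy); destruct (coord_le_enorm y1 y2 y3) as (E1 & E2 & E3).
  revert H1 H2 H3 E1 E2 E3; unfold Rabs; repeat destruct Rcase_abs; intros;
    repeat split; lra.
Qed.

Lemma boundary_complement_open (Om : R3 -> Prop) (x : R3) :
  ~ boundary Om x -> locally x (fun y => ~ boundary Om y).
Proof.
  intros H; destruct (classic (locally x Om)) as [Hl | Hl].
  - apply locally_locally in Hl; revert Hl; apply filter_imp; intros y Hy [_ Hb]; auto.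
  - assert (Hc : locally x (fun y => ~ Om y)).
    { apply NNPP; intros Hc; apply H; split; auto. }
    apply locally_locally in Hc; revert Hc; apply filter_imp; intros y Hy [Hb _]; auto.
Qed.

(** Off the boundary the bound is vacuous nearby, the boundary being closed. Covering all points
    allows the Heine-Borel argument to run on a cube instead of the boundary itself. *)
Lemma data_locally_bounded (Om : R3 -> Prop) (g : R3 -> C) (x : R3) :
  data Om g ->
  exists S, locally x (fun y => boundary Om y -> Cmod (g y) <= S).
Proof.
  intros Hg; destruct (classic (boundary Om x)) as [Hx | Hx].
  - exists (Cmod (g x) + 1).
    generalize (proj1 (continuous_within_iff _ _) Hg x Hx 1 Rlt_0_1).
    apply filter_imp; intros y H Hy; specialize (H Hy).
    replace (g y) with (g x + (g y - g x))%C by ring.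
    eapply Rle_trans; [apply Cmod_triangle | lra].
  - exists 0; generalize (boundary_complement_open Om x Hx).
    apply filter_imp; tauto.
Qed.

Lemma data_bounded (Om : R3 -> Prop) (g : R3 -> C) :
  bounded_set Om -> data Om g ->
  exists S, 0 < S /\ forall y, boundary Om y -> Cmod (g y) <= S.
Proof.
  intros HOm Hg; destruct (boundary_bounded Om HOm) as [M HM].
  set (pt := fun t : Tn 3 R => let '(t1, (t2, (t3, _))) := t in (t1, t2, t3) : R3).
  assert (Hloc : forall t : Tn 3 R, exists d : posreal, exists S, forall y1 y2 y3,
     close_n 3 d (y1, (y2, (y3, tt))) t -> boundary Om (y1, y2, y3) ->
     Cmod (g (y1, y2, y3)) <= S).
  { intros (t1 & t2 & t3 & []).
    destruct (data_locally_bounded Om g (t1, t2, t3) Hg) as [S HS].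
    apply locally_cube in HS; destruct HS as [d Hd].
    exists d, S; intros y1 y2 y3 (H1 & H2 & H3 & _); now apply Hd. }
  (* [compactness_list] wants the gauge as a function into [posreal], so the local radii are chosen;
     its doubly negated conclusion is why [NNPP] appears below. *)
  set (delta := fun t => proj1_sig (constructive_indefinite_description _ (Hloc t))).
  assert (Hdelta : forall t, exists S, forall y1 y2 y3,
     close_n 3 (delta t) (y1, (y2, (y3, tt))) t -> boundary Om (y1, y2, y3) ->
     Cmod (g (y1, y2, y3)) <= S).
  { intros t; unfold delta; now destruct constructive_indefinite_description. }
  pose proof (NNPP _ (compactness_list 3 (- M, (- M, (- M, tt))) (M, (M, (M, tt))) delta))
    as [l Hl].
  assert (HS : exists S, 0 < S /\ forall t, In t l -> forall y1 y2 y3,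
     close_n 3 (delta t) (y1, (y2, (y3, tt))) t -> boundary Om (y1, y2, y3) ->
     Cmod (g (y1, y2, y3)) <= S).
  { clear Hl; induction l as [|t l (S & HS & IH)].
    - exists 1; split; [lra | intros t []].
    - destruct (Hdelta t) as [S' HS']; exists (Rmax S S'); split.
      + eapply Rlt_le_trans; [apply HS | apply Rmax_l].
      + intros t' [<- | Ht'] y1 y2 y3 Hc Hb.
        * eapply Rle_trans; [now apply HS' | apply Rmax_r].
        * eapply Rle_trans; [now apply (IH t') | apply Rmax_l]. }
  destruct HS as (S & HS & H); exists S; split; [auto |].
  intros [[y1 y2] y3] Hy.
  destruct (HM _ _ _ Hy) as (B1 & B2 & B3).
  destruct (Hl (y1, (y2, (y3, tt)))) as (t & Ht & _ & Hc).
  - simpl; repeat split;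
      revert B1 B2 B3; unfold Rabs; repeat destruct Rcase_abs; intros; lra.
  - now apply (H t).
Qed.

(** Turns operator convergence on compact sets into convergence at the fixed point [x]. *)
Lemma compact_singleton (A : R3 -> Prop) (x : R3) :
  A x -> compact_subset (fun y => y = x) A.
Proof.
  intros Hx; split; [| split].
  - intros [[y1 y2] y3] Hy; destruct x as [[x1 x2] x3].
    apply NNPP; intros Hn; apply Hy; apply locally_cube.
    assert (Hd : 0 < Rabs (y1 - x1) + Rabs (y2 - x2) + Rabs (y3 - x3)).
    { apply Rnot_le_lt; intros H; apply Hn.
      pose proof (Rabs_pos (y1 - x1)); pose proof (Rabs_pos (y2 - x2));
      pose proof (Rabs_pos (y3 - x3)).
      assert (Z : forall a b, Rabs (a - b) <= 0 -> a = b).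
      { intros a b Hab; pose proof (Rabs_pos (a - b)).
        apply Rminus_diag_uniq; destruct (Req_dec (a - b) 0) as [|K]; auto.
        apply Rabs_no_R0 in K; lra. }
      rewrite (Z y1 x1), (Z y2 x2), (Z y3 x3); auto; lra. }
    set (d := Rabs (y1 - x1) + Rabs (y2 - x2) + Rabs (y3 - x3)) in *.
    exists (mkposreal (d / 3) ltac:(lra)); simpl; intros z1 z2 z3 H1 H2 H3 E.
    injection E as -> -> ->.
    rewrite (Rabs_minus_sym x1), (Rabs_minus_sym x2), (Rabs_minus_sym x3) in *.
    unfold d in *; lra.
  - exists (enorm x); intros y ->; lra.
  - intros y ->; auto.
Qed.

(** * Local expansions of the solution operator and of the data *)

(** Beyond [n0] a term is the difference of two consecutive partial sums, both within 1 of the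
    limit, hence below 2; the finitely many earlier terms are bounded one at a time. The index
    ranges over unit data for operators and over boundary points for data. *)
Lemma uniform_coeff_bound (I : Type) (P : I -> Prop) (a : nat -> I -> C) (f : I -> C)
  (r : R) :
  0 < r ->
  (forall j, exists M, forall i, P i -> Cmod (a j i) <= M) ->
  (forall eps, 0 < eps -> exists n0, forall n, (n0 <= n)%nat -> forall i, P i ->
     Cmod (Csum (fun j => RtoC r ^ j * a j i)%C n - f i) < eps) ->
  exists S, 0 < S /\ forall j i, P i -> Cmod (a j i) * r ^ j <= S.
Proof.
  intros Hr HM Hf; destruct (Hf 1 Rlt_0_1) as [n0 Hn0].
  assert (Hfin : forall n, exists S, 0 < S /\ forall j, (j <= n)%nat -> forall i, P i ->
             Cmod (a j i) * r ^ j <= S).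
  { assert (step : forall j, exists S, forall i, P i -> Cmod (a j i) * r ^ j <= S).
    { intros j; destruct (HM j) as [M HMj]; exists (M * r ^ j); intros i Hi.
      apply Rmult_le_compat_r; [apply pow_le; lra | auto]. }
    intros n; induction n as [|n (S & HS & IH)].
    - destruct (step 0%nat) as [M HM0]; exists (Rmax 1 M); split.
      + eapply Rlt_le_trans; [apply Rlt_0_1 | apply Rmax_l].
      + intros j Hj i Hi; replace j with 0%nat by lia.
        eapply Rle_trans; [now apply HM0 | apply Rmax_r].
    - destruct (step (Datatypes.S n)) as [M HMn]; exists (Rmax S M); split.
      + eapply Rlt_le_trans; [apply HS | apply Rmax_l].
      + intros j Hj i Hi; destruct (Nat.eq_dec j (Datatypes.S n)) as [-> | Hne].
        * eapply Rle_trans; [now apply HMn | apply Rmax_r].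
        * eapply Rle_trans; [apply IH; [lia | auto] | apply Rmax_l]. }
  destruct (Hfin n0) as (S & HS & HSb); exists (S + 2); split; [lra |].
  intros j i Hi; destruct (Nat.le_gt_cases j n0) as [Hj | Hj].
  - specialize (HSb j Hj i Hi); lra.
  - destruct j as [|m]; [lia |].
    pose proof (Hn0 m ltac:(lia) i Hi) as B1.
    pose proof (Hn0 (Datatypes.S m) ltac:(lia) i Hi) as B2.
    rewrite Csum_S in B2; set (u := Csum _ m) in *.
    assert (E : Cmod (a (Datatypes.S m) i) * r ^ Datatypes.S m =
                Cmod (RtoC r ^ Datatypes.S m * a (Datatypes.S m) i)).
    { rewrite Cmod_mult, Cmod_pow, Cmod_R, Rabs_pos_eq by lra; ring. }
    rewrite E; set (q := (RtoC r ^ Datatypes.S m * a (Datatypes.S m) i)%C) in *.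
    replace q with ((u + q - f i) - (u - f i))%C by ring.
    eapply Rle_trans; [apply Cmod_triangle_minus | lra].
Qed.

Lemma bounded_operator_scal (Om : R3 -> Prop) (T : operator) (a : C) (g : R3 -> C) (x : R3) :
  bounded_operator Om T -> data Om g -> exterior Om x ->
  T (fun y => a * g y)%C x = (a * T g x)%C.
Proof.
  intros (_ & HT & _) Hg Hx.
  assert (H0 : data Om (fun _ => 0%C)) by apply continuous_within_const.
  (* The linearity clause at zero data with factor 1 reads [q = q + q]. *)
  assert (E0 : T (fun _ => 0%C) x = 0%C).
  { pose proof (HT 1%C (fun _ => 0%C) (fun _ => 0%C) x H0 H0 Hx) as H; cbv beta in H.
    replace (fun _ : R3 => 1 * 0 + 0)%C with (fun _ : R3 => RtoC 0) in H
      by (apply functional_extensionality; intros; ring).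
    set (q := T (fun _ => 0%C) x) in *.
    replace q with (1 * q + q - q)%C by ring; rewrite <- H; ring. }
  pose proof (HT a g (fun _ => 0%C) x Hg H0 Hx) as H; cbv beta in H.
  replace (fun y => a * g y + 0)%C with (fun y => a * g y)%C in H
    by (apply functional_extensionality; intros; ring).
  rewrite H, E0; ring.
Qed.

Lemma unit_ball_scal (Om : R3 -> Prop) (g : R3 -> C) (s : R) :
  0 < s -> data Om g -> (forall y, boundary Om y -> Cmod (g y) <= s) ->
  data_unit_ball Om (fun y => RtoC (/ s) * g y)%C.
Proof.
  intros Hs Hg Hb; split; [now apply continuous_within_scal |].
  intros y Hy; rewrite Cmod_mult, Cmod_R, Rabs_pos_eq
    by (left; now apply Rinv_0_lt_compat).
  apply Rmult_le_reg_l with s; auto.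
  rewrite <- Rmult_assoc, Rinv_r, Rmult_1_l, Rmult_1_r by lra; auto.
Qed.

(* Near a point of analyticity, [B] is bounded, Lipschitz and differentiable
   with quadratic remainder, uniformly on bounded sets of data; [E k g] is the
   value at [x] of the derivative of [B] at [k] applied to [g]. *)
Definition local_expansion (Om : R3 -> Prop) (B : C -> operator) (k0 : C) (x : R3)
  (sigma K : R) (E : C -> (R3 -> C) -> C) : Prop :=
  forall k k', Cmod (k - k0) < sigma -> Cmod (k' - k0) < sigma ->
    solution_operator Om k (B k) -> solution_operator Om k' (B k') ->
    (forall a g h, data Om g -> data Om h ->
       B k (fun y => a * g y + h y)%C x = (a * B k g x + B k h x)%C) /\
    forall g s, data Om g -> 0 < s -> (forall y, boundary Om y -> Cmod (g y) <= s) ->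
      Cmod (B k g x) <= K * s /\
      Cmod (B k g x - B k' g x) <= K * s * Cmod (k - k') /\
      Cmod (E k' g) <= K * s /\
      Cmod (B k g x - B k' g x - E k' g * (k - k')) <= K * s * Cmod (k - k') ^ 2.

Lemma op_analytic_expansion (Om : R3 -> Prop) (B : C -> operator) (k0 : C) (x : R3) :
  bounded_set Om -> exterior Om x -> op_analytic_at Om B k0 ->
  exists sigma K E, 0 < sigma /\ 0 < K /\ local_expansion Om B k0 x sigma K E.
Proof.
  intros HOm Hx (rho & A & Hrho & HA & Hlim).
  (* The coefficients are bounded through convergence at [k0 + r], strictly inside the disc. *)
  set (r := rho / 2); assert (Hr : 0 < r) by (unfold r; lra).
  pose proof (compact_singleton (exterior Om) x Hx) as Hcs.
  assert (HS : exists S, 0 < S /\ forall j g, data_unit_ball Om g ->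
             Cmod (A j g x) * r ^ j <= S).
  { apply (uniform_coeff_bound (R3 -> C) (data_unit_ball Om) (fun j g => A j g x)
             (fun g => B (k0 + RtoC r)%C g x) r Hr).
    - intros j; destruct (HA j) as (_ & _ & Hb).
      destruct (Hb _ Hcs) as [M HM]; exists M; intros g Hg; now apply HM.
    - intros eps He.
      assert (Hk : Cmod (k0 + RtoC r - k0) < rho).
      { replace (k0 + RtoC r - k0)%C with (RtoC r) by ring.
        rewrite Cmod_R, Rabs_pos_eq; unfold r; lra. }
      destruct (Hlim _ Hk _ Hcs eps He) as [n0 Hn0]; exists n0; intros n Hn g Hg.
      specialize (Hn0 n Hn g x Hg eq_refl); unfold op_psum in Hn0.
      replace (k0 + RtoC r - k0)%C with (RtoC r) in Hn0 by ring; exact Hn0. }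
  destruct HS as (S & HS & HSb).
  (* [operator_lim] tests unit data only: [g] is scaled down by its bound [s], and homogeneity of
     [B k] and of each [A j] undoes the scaling. *)
  assert (Hsum : forall k g, Cmod (k - k0) < rho -> solution_operator Om k (B k) ->
            data Om g -> power_sum (fun j => A j g x) (k - k0)%C (B k g x)).
  { intros k g Hk Hsol Hg.
    destruct (data_bounded Om g HOm Hg) as (s & Hs & Hb).
    pose proof (unit_ball_scal Om g s Hs Hg Hb) as Hu.
    assert (E : forall u : C, (RtoC s * (RtoC (/ s) * u))%C = u).
    { intros u; rewrite Cmult_assoc, <- RtoC_mult, Rinv_r by lra; ring. }
    unfold power_sum.
    rewrite <- (E (B k g x)), <- (solution_operator_scal Om k (B k)) by auto.
    eapply Cconv_ext.
    2: { apply (Cconv_scal (RtoC s)); intros eps He.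
         destruct (Hlim k Hk _ Hcs eps He) as [n0 Hn0]; exists n0; intros n Hn.
         exact (Hn0 n Hn _ x Hu eq_refl). }
    intros n; unfold op_psum; rewrite <- Csum_scal; apply Csum_ext; intros j.
    rewrite (bounded_operator_scal Om) by auto.
    transitivity ((k - k0) ^ j * (RtoC s * (RtoC (/ s) * A j g x)))%C; [ring | now rewrite E]. }
  destruct (power_sum_taylor r Hr) as (K & HK & Htaylor).
  exists (r / 8), (K * S), (fun k g => dpower_sum (fun j => A j g x) (k - k0)%C).
  split; [lra |]; split; [now apply Rmult_lt_0_compat |].
  intros k k' Hk Hk' Hsol Hsol'; split.
  - intros a g h Hg Hh.
    assert (Hgh : data Om (fun y => a * g y + h y)%C) by now apply continuous_within_lin.
    (* Linearity of [B k] comes termwise from the [A j], by uniqueness of the limit. *)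
    eapply Cconv_unique; [apply Hsum; auto; unfold r in *; lra |].
    eapply Cconv_ext; [| apply Cconv_plus; [apply Cconv_scal |]];
      [| apply Hsum; auto; unfold r in *; lra | apply Hsum; auto; unfold r in *; lra].
    intros n; simpl; rewrite <- Csum_scal, <- Csum_plus; apply Csum_ext; intros j.
    destruct (HA j) as (_ & HAl & _); rewrite HAl by auto; ring.
  - intros g s Hg Hs Hb.
    replace (K * S * s) with (K * (S * s)) by ring.
    replace (k - k')%C with ((k - k0) - (k' - k0))%C by ring.
    apply (Htaylor (fun j => A j g x)).
    + intros j.
      pose proof (HSb j _ (unit_ball_scal Om g s Hs Hg Hb)) as H.
      rewrite (bounded_operator_scal Om), Cmod_mult, Cmod_R, Rabs_pos_eq in H
        by (auto; left; now apply Rinv_0_lt_compat).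
      apply (Rmult_le_compat_l s) in H; [| lra].
      replace (s * (/ s * Cmod (A j g x) * r ^ j)) with (Cmod (A j g x) * r ^ j) in H
        by (field; lra).
      lra.
    + lra.
    + lra.
    + apply Hsum; auto; unfold r in *; lra.
    + apply Hsum; auto; unfold r in *; lra.
Qed.

(** At the centre only the zeroth term survives, so [F z] agrees on the boundary with the continuous
    [c 0]. *)
Lemma data_analytic_at_data (Om : R3 -> Prop) (F : C -> R3 -> C) (z : C) :
  data_analytic_at Om F z -> data Om (F z).
Proof.
  intros (rho & c & Hrho & Hc & H).
  apply continuous_within_ext with (c 0%nat); [| apply Hc].
  intros y Hy.
  assert (E : (c 0%nat y - F z y)%C = 0%C).
  { apply Cmod_le_eps_0; intros eps He.
    destruct (H z) with (eps := eps) as [n0 Hn0]; auto.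
    { replace (z - z)%C with (RtoC 0) by ring; now rewrite Cmod_0. }
    specialize (Hn0 n0 (le_n _) y Hy).
    replace (c 0%nat y) with (Csum (fun m => (z - z) ^ m * c m y)%C n0); auto.
    clear; induction n0 as [|n IH].
    - rewrite Csum_O; simpl; ring.
    - rewrite Csum_S, IH; simpl; ring. }
  replace (c 0%nat y) with (c 0%nat y - F z y + F z y)%C by ring; rewrite E; ring.
Qed.

(** A product rule for an operator applied to a vector: vary the operator at fixed data, vary the
    data at fixed operator, and what remains is a product of two increments, hence quadratic. *)
Lemma holo_at_operator_data (Om : R3 -> Prop) (B : C -> operator) (p : C -> C)
  (G : C -> R3 -> C) (x : R3) (z0 : C) (delta : R) :
  bounded_set Om -> exterior Om x -> 0 < delta ->
  op_analytic_at Om B (p z0) -> holo_at p z0 -> data_analytic_at Om G z0 ->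
  (forall z, Cmod (z - z0) < delta ->
     solution_operator Om (p z) (B (p z)) /\ data Om (G z)) ->
  holo_at (fun z => B (p z) (G z) x) z0.
Proof.
  intros HOm Hx Hdelta HB Hp (rho & c & Hrho & Hc & HG) Hgood.
  destruct (op_analytic_expansion Om B (p z0) x HOm Hx HB)
    as (sigma & KB & E & Hsigma & HKB & Hexp).
  apply holo_at_chart in Hp; destruct Hp as (rp & Kp & Dp & Hrp & HKp & Tp & Lp).
  set (r := rho / 2); assert (Hr : 0 < r) by (unfold r; lra).
  assert (HS : exists S, 0 < S /\ forall m y, boundary Om y -> Cmod (c m y) * r ^ m <= S).
  { apply (uniform_coeff_bound R3 (boundary Om) c (G (z0 + RtoC r)%C) r Hr).
    - intros m; destruct (data_bounded Om (c m) HOm (Hc m)) as (s & _ & Hs).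
      now exists s.
    - intros eps He; destruct (HG (z0 + RtoC r)%C) with (eps := eps) as [n0 Hn0]; auto.
      { replace (z0 + RtoC r - z0)%C with (RtoC r) by ring.
        rewrite Cmod_R, Rabs_pos_eq; unfold r; lra. }
      exists n0; intros n Hn y Hy; specialize (Hn0 n Hn y Hy).
      replace (z0 + RtoC r - z0)%C with (RtoC r) in Hn0 by ring; exact Hn0. }
  destruct HS as (S & HS & HSb).
  destruct (power_sum_taylor r Hr) as (K2 & HK2 & Htaylor).
  (* In this order the radii secure solvability, the chart of [p], the Taylor estimate for [G], and
     that [p z] stays where [B] expands. *)
  set (rad := Rmin (Rmin delta rp) (Rmin (r / 8) (sigma / (Kp + 1)))).
  assert (Hs1 : 0 < sigma / (Kp + 1)) by (apply Rdiv_lt_0_compat; lra).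
  assert (Hrad : 0 < rad) by (unfold rad; repeat apply Rmin_pos; lra).
  assert (R1 : rad <= delta) by (unfold rad; eapply Rle_trans; apply Rmin_l).
  assert (R2 : rad <= rp)
    by (unfold rad; eapply Rle_trans; [apply Rmin_l | apply Rmin_r]).
  assert (R3' : rad <= r / 8)
    by (unfold rad; eapply Rle_trans; [apply Rmin_r | apply Rmin_l]).
  assert (R4 : rad <= sigma / (Kp + 1))
    by (unfold rad; eapply Rle_trans; [apply Rmin_r | apply Rmin_r]).
  assert (Hk : forall z, Cmod (z - z0) < rad -> Cmod (p z - p z0) < sigma).
  { intros z Hz; destruct (Lp z z0) as (_ & _ & L & _); [lra | |].
    { replace (z0 - z0)%C with (RtoC 0) by ring; now rewrite Cmod_0. }
    eapply Rle_lt_trans; [apply L |].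
    apply Rle_lt_trans with ((Kp + 1) * Cmod (z - z0)).
    - apply Rmult_le_compat_r; [apply Cmod_ge_0 | lra].
    - apply Rlt_le_trans with ((Kp + 1) * rad).
      + apply Rmult_lt_compat_l; lra.
      + apply Rle_trans with ((Kp + 1) * (sigma / (Kp + 1))).
        * apply Rmult_le_compat_l; lra.
        * right; field; lra. }
  assert (HGsum : forall z y, Cmod (z - z0) < rad -> boundary Om y ->
            power_sum (fun m => c m y) (z - z0)%C (G z y)).
  { intros z y Hz Hy eps He.
    destruct (HG z) with (eps := eps) as [n0 Hn0]; [unfold r in *; lra | auto |].
    exists n0; intros n Hn; now apply Hn0. }
  set (s := K2 * S); assert (Hs : 0 < s) by now apply Rmult_lt_0_compat.
  assert (HGb : forall z w y, Cmod (z - z0) < rad -> Cmod (w - z0) < rad ->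
            boundary Om y ->
            Cmod (G z y) <= s /\ Cmod (G z y - G w y) <= s * Cmod (z - w)).
  { intros z w y Hz Hw Hy.
    replace (z - w)%C with ((z - z0) - (w - z0))%C by ring.
    destruct (Htaylor (fun m => c m y) S (z - z0)%C (w - z0)%C (G z y) (G w y))
      as (T1 & T2 & _); auto; lra. }
  (* One summand for each of the four terms into which the remainder is split at the end, in the
     same order. *)
  exists rad, (KB * s * Kp ^ 2 + KB * s * Kp + K2 * (KB * S) + KB * s * Kp).
  exists (fun w => E (p w) (G w) * Dp w +
                   dpower_sum (fun m => B (p w) (c m) x) (w - z0))%C.
  split; [auto |]; intros z w Hz Hw.
  destruct (Hgood z ltac:(lra)) as [solz dz]; destruct (Hgood w ltac:(lra)) as [solw dw].
  pose proof (Hk z Hz) as kz; pose proof (Hk w Hw) as kw.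
  destruct (Lp z w) as (_ & _ & Lpzw & _); [lra | lra |].
  specialize (Tp z w ltac:(lra) ltac:(lra)).
  destruct (Hexp _ _ kz kw solz solw) as [linz bz].
  destruct (Hexp _ _ kw kw solw solw) as [linw bw].
  (* For distinct points [s * d] is positive, as the bounds for the data increment [dG] require. *)
  destruct (Ceq_dec z w) as [<- | Hzw].
  { match goal with |- Cmod ?q <= _ => replace q with (RtoC 0) by ring end.
    replace (z - z)%C with (RtoC 0) by ring; rewrite Cmod_0; right; ring. }
  set (d := Cmod (z - w)) in *.
  assert (Hd : 0 < d).
  { apply Cmod_gt_0; intros Ed; apply Hzw.
    replace z with ((z - w) + w)%C by ring; rewrite Ed; ring. }
  set (dG := fun y => (-(1) * G w y + G z y)%C).
  assert (HdG : data Om dG) by now apply continuous_within_lin.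
  assert (Ez : B (p z) dG x = (B (p z) (G z) x - B (p z) (G w) x)%C)
    by (unfold dG; rewrite linz by auto; ring).
  assert (Ew : B (p w) dG x = (B (p w) (G z) x - B (p w) (G w) x)%C)
    by (unfold dG; rewrite linw by auto; ring).
  destruct (bz (G w) s dw Hs) as (_ & _ & bE & b1).
  { intros y Hy; now apply (HGb w w y). }
  destruct (bz dG (s * d) HdG) as (_ & b4 & _).
  { now apply Rmult_lt_0_compat. }
  { intros y Hy; unfold dG; replace (-(1) * G w y + G z y)%C with (G z y - G w y)%C by ring.
    now apply HGb. }
  (* With the operator frozen at [p w], it may be applied termwise: the series of [G] converges
     uniformly on the boundary and the operator is bounded by [KB]. *)
  assert (Hpow : forall u, Cmod (u - z0) < rad -> data Om (G u) ->
            power_sum (fun m => B (p w) (c m) x) (u - z0)%C (B (p w) (G u) x)).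
  { intros u Hu Hdu eps He.
    assert (He' : 0 < eps / (2 * KB)) by (apply Rdiv_lt_0_compat; lra).
    destruct (HG u) with (eps := eps / (2 * KB)) as [n0 Hn0];
      [unfold r in *; lra | auto |].
    exists n0; intros n Hn.
    assert (Hlin : B (p w) (fun y => Csum (fun m => (u - z0) ^ m * c m y)%C n) x =
              Csum (fun m => (u - z0) ^ m * B (p w) (c m) x)%C n).
    { clear Hn; induction n as [|n IH].
      - rewrite Csum_O.
        replace (fun y => Csum (fun m => (u - z0) ^ m * c m y)%C 0) with (c 0%nat).
        + simpl; ring.
        + apply functional_extensionality; intros y; rewrite Csum_O; simpl; ring.
      - rewrite Csum_S, <- IH.
        replace (fun y => Csum (fun m => (u - z0) ^ m * c m y)%C (Datatypes.S n))
          with (fun y => (u - z0) ^ Datatypes.S n * c (Datatypes.S n) y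
                         + Csum (fun m => (u - z0) ^ m * c m y)%C n)%C.
        + rewrite linw; [ring | apply Hc | now apply continuous_within_Csum].
        + apply functional_extensionality; intros y; rewrite Csum_S; ring. }
    assert (Hcs : data Om (fun y => Csum (fun m => (u - z0) ^ m * c m y)%C n))
      by now apply continuous_within_Csum.
    destruct (bw (fun y => -(1) * G u y + Csum (fun m => (u - z0) ^ m * c m y) n)%C
                (eps / (2 * KB))) as (b & _).
    - now apply continuous_within_lin.
    - auto.
    - intros y Hy; left.
      replace (-(1) * G u y + Csum (fun m => (u - z0) ^ m * c m y) n)%C
        with (Csum (fun m => (u - z0) ^ m * c m y) n - G u y)%C by ring.
      now apply Hn0.
    - rewrite linw, Hlin in b by auto.
      replace (KB * (eps / (2 * KB))) with (eps / 2) in b by (field; lra).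
      match goal with |- Cmod ?q < _ =>
        match type of b with Cmod ?q' <= _ => replace q with q' by ring end end.
      lra. }
  destruct (Htaylor (fun m => B (p w) (c m) x) (KB * S) (z - z0)%C (w - z0)%C
              (B (p w) (G z) x) (B (p w) (G w) x)) as (_ & _ & _ & b3); auto; try lra.
  { intros m.
    assert (Hrm : 0 < r ^ m) by (apply pow_lt; auto).
    destruct (bw (c m) (S / r ^ m)) as (b & _); auto.
    - now apply Rdiv_lt_0_compat.
    - intros y Hy; apply Rmult_le_reg_r with (r ^ m); auto.
      unfold Rdiv; rewrite Rmult_assoc, Rinv_l, Rmult_1_r by lra; auto.
    - apply (Rmult_le_compat_r (r ^ m)) in b; [| lra].
      replace (KB * (S / r ^ m) * r ^ m) with (KB * S) in b by (field; lra); auto. }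
  replace (z - z0 - (w - z0))%C with (z - w)%C in b3 by ring; fold d in b3.
  (* The first two terms are the chain rule for [B] and [p] at the data [G w], the third is the
     Taylor remainder in the data, and the last is the mixed increment. *)
  match goal with |- Cmod ?q <= _ => replace q with
    ((B (p z) (G w) x - B (p w) (G w) x - E (p w) (G w) * (p z - p w))
     + E (p w) (G w) * (p z - p w - Dp w * (z - w))
     + (B (p w) (G z) x - B (p w) (G w) x
        - dpower_sum (fun m => B (p w) (c m) x) (w - z0) * (z - w))
     + (B (p z) dG x - B (p w) dG x))%C by (rewrite Ez, Ew; ring) end.
  eapply Rle_trans; [apply Cmod_triangle |].
  eapply Rle_trans; [apply Rplus_le_compat_r, Cmod_triangle |].
  eapply Rle_trans; [apply Rplus_le_compat_r, Rplus_le_compat_r, Cmod_triangle |].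
  rewrite (Cmod_mult (E _ _)).
  pose proof (Cmod_ge_0 (p z - p w)) as Hpp.
  assert (HKs : 0 < KB * s) by now apply Rmult_lt_0_compat.
  assert (Q1 : KB * s * Cmod (p z - p w) ^ 2 <= KB * s * (Kp * d) ^ 2)
    by (apply Rmult_le_compat_l; [lra |]; apply pow_incr; auto).
  assert (Q2 : Cmod (E (p w) (G w)) * Cmod (p z - p w - Dp w * (z - w))
               <= KB * s * (Kp * d ^ 2))
    by (apply Rmult_le_compat; auto; apply Cmod_ge_0).
  assert (Q4 : KB * (s * d) * Cmod (p z - p w) <= KB * (s * d) * (Kp * d)).
  { apply Rmult_le_compat_l; auto; apply Rmult_le_pos; [lra |].
    apply Rmult_le_pos; lra. }
  replace (KB * s * (Kp * d) ^ 2) with (KB * s * Kp ^ 2 * d ^ 2) in Q1 by ring.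
  replace (KB * (s * d) * (Kp * d)) with (KB * s * Kp * d ^ 2) in Q4 by ring.
  lra.
Qed.

(** * The wavenumber, the radii, and the conclusion *)

Lemma holo_at_k_of (gam : nat -> R) (N : nat) (c dt : R) (z0 : C) :
  holo_at (k_of gam N c dt) z0.
Proof.
  apply (holo_at_mult (fun z => Ci * gamma_poly gam N z)%C (fun _ => / RtoC (c * dt))%C);
    [| apply holo_at_const].
  apply (holo_at_mult (fun _ => Ci) (gamma_poly gam N)); [apply holo_at_const |].
  apply (holo_at_Csum (fun n z => RtoC (gam n) * z ^ n)%C); intros j.
  apply (holo_at_mult (fun _ => RtoC (gam j)) (fun z => z ^ j)%C); [apply holo_at_const |].
  apply (holo_at_pow (fun z => z)), holo_at_id.
Qed.

Lemma Rbar_min_Finite (a b : Rbar) (r : R) :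
  Rbar_min a b = Finite r -> Rbar_le r a /\ Rbar_le r b.
Proof.
  destruct a as [a| |], b as [b| |]; simpl; intros H; try discriminate;
    injection H as <-; repeat split; auto; try apply Rle_refl;
    [apply Rmin_l | apply Rmin_r].
Qed.

Lemma not_pole_below_lambda_B (Om : R3 -> Prop) (B : C -> operator) (gam : nat -> R)
  (N : nat) (c dt r : R) (z : C) :
  Rbar_le r (lambda_B Om B gam N c dt) -> Cmod z < r ->
  ~ op_pole Om B (k_of gam N c dt z).
Proof.
  intros Hr Hz Hp.
  assert (H : Rbar_le (lambda_B Om B gam N c dt) (Cmod z))
    by (apply Glb_Rbar_correct; eauto).
  pose proof (Rbar_le_trans _ _ _ Hr H) as H'; simpl in H'; lra.
Qed.

(** Otherwise no admissible radius exceeds [Cmod z], which would then bound the supremum. *)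
Lemma genG_analytic_below_lambda_G (Om : R3 -> Prop) (g : R -> R3 -> C) (dt r : R) (z : C) :
  Rbar_le r (lambda_G Om g dt) -> Cmod z < r ->
  data_analytic_at Om (genG g dt) z.
Proof.
  intros Hr Hz; apply NNPP; intros Hn.
  assert (H : Rbar_le (lambda_G Om g dt) (Cmod z)).
  { apply Lub_Rbar_correct; intros q Hq; simpl; apply Rnot_lt_le; intros Hlt.
    apply Hn, (Hq z Hlt). }
  pose proof (Rbar_le_trans _ _ _ Hr H) as H'; simpl in H'; lra.
Qed.

Theorem lemma4p3 :
  forall (Om : R3 -> Prop) (B : C -> operator)
         (gam : nat -> R) (N : nat) (c dt : R)
         (g : R -> R3 -> C) (lamU : R) (x : R3),
    bounded_domain Om ->
    (* B is the solution operator, meromorphic, with poles in Im k < 0 *)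
    op_meromorphic Om B ->
    (forall k : C, op_pole Om B k -> Im k < 0) ->
    (forall k : C, ~ op_pole Om B k -> solution_operator Om k (B k)) ->
    (* gamma is a nonconstant polynomial *)
    (forall n : nat, (N < n)%nat -> gam n = 0) ->
    (exists n : nat, (1 <= n)%nat /\ gam n <> 0) ->
    0 < c -> 0 < dt ->
    (forall t : R, 0 <= t -> data Om (g t)) ->
    Rbar_min (lambda_B Om B gam N c dt) (lambda_G Om g dt) = Finite lamU ->
    exterior Om x ->
    (forall lamh : R, 0 < lamh < lamU ->
       exists M : R,
         max_on_circle (fun z => Cmod (U_d B gam N c dt g z x)) lamh M /\
         forall (lam : R) (n : nat), 0 < lam < lamU ->
           Cmod (u_d B gam N c dt g lam n x) <= M * / lamh ^ n) /\
    (forall eps : R, 0 < eps < lamU ->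
       exists (K : R) (n0 : nat),
         forall (lam : R) (n : nat), 0 < lam < lamU -> (n0 <= n)%nat ->
           Cmod (u_d B gam N c dt g lam n x) <= K * / (lamU - eps) ^ n).
Proof.
  intros Om B gam N c dt g lamU x HOm Hmero _ Hsol _ _ _ _ _ Hmin Hx.
  apply Rbar_min_Finite in Hmin; destruct Hmin as [HlB HlG].
  assert (Hholo : forall z, Cmod z < lamU ->
            holo_at (fun z => U_d B gam N c dt g z x) z).
  { intros z Hz.
    pose proof (not_pole_below_lambda_B Om B gam N c dt lamU z HlB Hz) as Hnp.
    (* The disc of radius [lamU - Cmod z] around [z] stays below [lamU], so no pole is met and the
       data stay analytic there. *)
    apply (holo_at_operator_data Om B (k_of gam N c dt) (genG g dt) x z (lamU - Cmod z)).
    - apply HOm.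
    - exact Hx.
    - lra.
    - destruct (Hmero (k_of gam N c dt z)) as [Ha | Hp]; [exact Ha | contradiction].
    - apply holo_at_k_of.
    - now apply genG_analytic_below_lambda_G with lamU.
    - intros w Hw.
      assert (Hw' : Cmod w < lamU).
      { replace w with (z + (w - z))%C by ring.
        eapply Rle_lt_trans; [apply Cmod_triangle | lra]. }
      split.
      + now apply Hsol, not_pole_below_lambda_B with lamU.
      + now apply data_analytic_at_data, genG_analytic_below_lambda_G with lamU. }
  assert (Hbound : forall lamh, 0 < lamh < lamU ->
       exists M, max_on_circle (fun z => Cmod (U_d B gam N c dt g z x)) lamh M /\
         forall lam n, 0 < lam < lamU ->
           Cmod (u_d B gam N c dt g lam n x) <= M * / lamh ^ n).
  { intros lamh Hl.
    destruct (Cmod_circle_max (fun z => U_d B gam N c dt g z x) lamh) as [M HM];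
      [lra | intros z Hz; apply Hholo; lra |].
    exists M; split; [exact HM |]; intros lam n Hlam.
    apply (cauchy_coefficient_bound (fun z => U_d B gam N c dt g z x) lamU); auto.
    apply HM. }
  split; [exact Hbound |].
  (* With the circle of radius [lamU - eps] the maximum is the implied constant, valid from [n = 0]
     on. *)
  intros eps Heps; destruct (Hbound (lamU - eps)) as (M & _ & HM); [lra |].
  exists M, 0%nat; intros lam n Hlam _; now apply HM.
Qed.
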